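(* The group $V_{xz}$ is a simple group.
   Context: Let $\tau=(\sqrt5-1)/2$, so $1=\tau+\tau^2$. $V_\tau$ is the group (under composition, $fg=f\circ g$) of left-continuous piecewise-linear bijections of $(0,1]$ with finitely many breakpoints (including discontinuities), all in $\mathbb Z[\tau]$, and all slopes integer powers of $\tau$. Trees. An $x$-caret subdivides an interval $(a,a+L]$ into $(a,a+\tau^2L]$ and $(a+\tau^2L,a+L]$; a $y$-caret subdivides it into $(a,a+\tau L]$ and $(a+\tau L,a+L]$. A tree is a finite rooted binary tree whose interior nodes (carets) are each of type $x$ or $y$; with root $(0,1]$, its leaves, ordered from left to right, give a subdivision of $(0,1]$. A triple $(T_1,\pi,T_2)$, with $T_1,T_2$ trees with $k$ leaves and $\pi$ a permutation of the $k$ leaf positions, represents the element of $V_\tau$ mapping the interval of leaf $i$ of $T_2$ affinely and increasingly onto the interval of leaf $\pi(i)$ of $T_1$. Generators. The spine $S_m$ is the tree with $m$ $x$-carets, each one after the first attached to the right leg of the previous one; its leaves are numbered $0,1,\dots,m$ from left to right. For $n\ge0$, $x_n$ (resp. $y_n$) is the element $(T,\mathrm{id},S_{n+2})$, where $T$ is obtained from $S_{n+1}$ by attaching an $x$-caret (resp. a $y$-caret) to its leaf number $n$. For $n\ge1$, $c_n=(S_{n+1},\gamma,S_{n+1})$, where $\gamma$ is the cyclic permutation sending leaf $0$ to leaf $n+1$ and leaf $i$ to leaf $i-1$ for $1\le i\le n+1$. For $n\ge 0$, $\pi_n=(S_{n+2},\sigma,S_{n+2})$, where $\sigma$ is the transposition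 exchanging leaves $n$ and $n+1$. The elements $x_n,y_n,c_n,\pi_n$ generate $V_\tau$. There is a (unique) surjective homomorphism $\varphi:V_\tau\to\mathbb Z/2\mathbb Z$ with $\varphi(x_n)=\varphi(c_n)=\varphi(\pi_n)=0$ and $\varphi(y_n)=1$ for all $n$. $V_{xz}$ denotes the kernel of $\varphi$. *)

(* Defs.v *)
From HB Require Import structures.
From mathcomp Require Import all_boot all_order all_fingroup all_algebra.
From mathcomp Require Import boolp classical_sets reals.

Set Implicit Arguments.
Unset Strict Implicit.
Unset Printing Implicit Defensive.

Import Order.TTheory GRing.Theory Num.Theory.
Local Open Scope classical_set_scope.
Local Open Scope ring_scope.

Record bijection (T : Type) := Bijection {
  bij_fun :> T -> T;
  bij_inv : T -> T;
  bij_funK : cancel bij_fun bij_inv;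
  bij_invK : cancel bij_inv bij_fun
}.

Section BijectionGroup.
Variable T : Type.
Implicit Types f g h : bijection T.

Lemma bijectionP f g : bij_fun f =1 bij_fun g -> f = g.
Proof.
case: f g => [f f' fK f'K] [g g' gK g'K] /= /funext fg; subst g.
have ff' : f' = g' by apply/funext => x; rewrite -{1}[x]g'K fK.
by subst g'; congr Bijection; exact: Prop_irrelevance.
Qed.

Definition bij_id : bijection T :=
  @Bijection T idfun idfun (fun _ => erefl) (fun _ => erefl).

Definition bij_comp f g : bijection T :=
  Bijection (can_comp (bij_funK f) (bij_funK g))
            (can_comp (bij_invK g) (bij_invK f)).

Definition bij_sym f : bijection T := Bijection (bij_invK f) (bij_funK f).

HB.instance Definition _ := gen_eqMixin (bijection T).
HB.instance Definition _ := gen_choiceMixin (bijection T).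

Fact bij_compA : associative bij_comp.
Proof. by move=> f g h; exact: bijectionP. Qed.
Fact bij_comp1f : left_id bij_id bij_comp.
Proof. by move=> f; exact: bijectionP. Qed.
Fact bij_compf1 : right_id bij_id bij_comp.
Proof. by move=> f; exact: bijectionP. Qed.
Fact bij_compVf : left_inverse bij_id bij_sym bij_comp.
Proof. by move=> f; apply: bijectionP => x; exact: bij_funK. Qed.
Fact bij_compfV : right_inverse bij_id bij_sym bij_comp.
Proof. by move=> f; apply: bijectionP => x; exact: bij_invK. Qed.

(* The product is composition: (f * g)%g x = f (g x). *)
HB.instance Definition _ := isGroup.Build (bijection T)
  bij_compA bij_comp1f bij_compf1 bij_compVf bij_compfV.

End BijectionGroup.

Definition subgroup (G : groupType) (H : set G) : Prop := group_closed (mem H).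

Definition normal_subgroup (G : groupType) (N H : set G) : Prop :=
  [/\ subgroup N, N `<=` H & forall x y, N x -> H y -> N (x ^ y)%g].

Definition simple_subgroup (G : groupType) (H : set G) : Prop :=
  [/\ subgroup H, H <> [set 1%g] &
      forall N : set G, normal_subgroup N H -> N = [set 1%g] \/ N = H].

Section Vtau.
Variable R : realType.

Definition tau : R := (Num.sqrt 5 - 1) / 2.

Definition Ztau : set R :=
  [set x | exists p : {poly int}, x = (map_poly intr p).[tau]].

(* The half-open interval (0, 1]. *)
Definition I01 : Type := {x : R | 0 < x <= 1}.

Definition left_continuous (f : I01 -> I01) : Prop :=
  forall (x : I01) (e : R), 0 < e ->
  exists2 d : R, 0 < d & forall y : I01,
    val x - d < val y <= val x -> `|val (f y) - val (f x)| < e.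

Definition tau_piecewise_linear (f : I01 -> I01) : Prop :=
  exists (n : nat) (a : nat -> R),
  [/\ a 0%N = 0 /\ a n = 1,
      forall i, (i < n)%N -> a i < a i.+1,
      forall i, (i <= n)%N -> Ztau (a i) &
      forall i, (i < n)%N -> exists (k : int) (c : R),
        forall x : I01, a i < val x < a i.+1 -> val (f x) = tau ^ k * val x + c].

Definition Vtau : set (bijection I01) :=
  [set f | left_continuous f /\ tau_piecewise_linear f].

End Vtau.

Inductive caret := CaretX | CaretY.

Inductive tree := Leaf | Node of caret & tree & tree.

Fixpoint nleaves (t : tree) : nat :=
  if t is Node _ l r then (nleaves l + nleaves r)%N else 1%N.

(* Attaches a caret of type c to leaf number n, counted from 0. *)
Fixpoint attach (c : caret) (t : tree) (n : nat) : tree :=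
  match t with
  | Leaf => if n == 0%N then Node c Leaf Leaf else Leaf
  | Node d l r => if (n < nleaves l)%N then Node d (attach c l n) r
                  else Node d l (attach c r (n - nleaves l))
  end.

Fixpoint spine (m : nat) : tree :=
  if m is m'.+1 then Node CaretX Leaf (spine m') else Leaf.

Section Elements.
Variable R : realType.

(* Relative position of the cut made by a caret. *)
Definition caret_cut (c : caret) : R :=
  match c with CaretX => tau R ^+ 2 | CaretY => tau R end.

(* The leaves of t, from left to right, when its root is the interval (a, b];
   the pair (u, v) stands for (u, v]. *)
Fixpoint leaf_intervals (t : tree) (a b : R) : seq (R * R) :=
  match t with
  | Leaf => [:: (a, b)]
  | Node c l r => let m := a + caret_cut c * (b - a) in
                  leaf_intervals l a m ++ leaf_intervals r m b
  end.

Definition leaf (t : tree) (i : nat) : R * R :=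
  nth (0, 0) (leaf_intervals t 0 1) i.

Definition represents (k : nat) (T1 : tree) (p : 'S_k) (T2 : tree)
    (f : I01 R -> I01 R) : Prop :=
  [/\ nleaves T1 = k, nleaves T2 = k &
      forall (i : 'I_k) (x : I01 R),
        let: (a, b) := leaf T2 i in
        let: (c, d) := leaf T1 (p i) in
        a < val x <= b -> val (f x) = c + (d - c) / (b - a) * (val x - a)].

Definition is_x (n : nat) (f : I01 R -> I01 R) : Prop :=
  represents (k := n.+3) (attach CaretX (spine n.+1) n) 1%g (spine n.+2) f.

Definition is_y (n : nat) (f : I01 R -> I01 R) : Prop :=
  represents (k := n.+3) (attach CaretY (spine n.+1) n) 1%g (spine n.+2) f.

(* ord_pred sends 0 to n+1 and i > 0 to i-1. *)
Definition cycle_perm (n : nat) : 'S_(n.+2) := perm (@ord_pred_inj n.+2).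

Definition is_c (n : nat) (f : I01 R -> I01 R) : Prop :=
  represents (spine n.+1) (cycle_perm n) (spine n.+1) f.

Definition is_pi (n : nat) (f : I01 R -> I01 R) : Prop :=
  represents (k := n.+3) (spine n.+2) (tperm (inord n) (inord n.+1))
    (spine n.+2) f.

(* phi is only meaningful on Vtau; its values elsewhere are irrelevant. *)
Definition is_varphi (phi : bijection (I01 R) -> 'Z_2) : Prop :=
  [/\ forall f g, Vtau f -> Vtau g -> phi (f * g)%g = phi f + phi g,
      forall z : 'Z_2, exists2 f, Vtau f & phi f = z,
      forall n f, Vtau f -> is_x n f -> phi f = 0,
      forall n f, Vtau f -> is_y n f -> phi f = 1 &
      (forall n f, (1 <= n)%N -> Vtau f -> is_c n f -> phi f = 0) /\
      (forall n f, Vtau f -> is_pi n f -> phi f = 0)].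

Definition Vxz (phi : bijection (I01 R) -> 'Z_2) : set (bijection (I01 R)) :=
  [set f | Vtau f /\ phi f = 0].

End Elements.

(* Main.v *)
Require Import Defs.
From mathcomp Require Import all_boot all_order all_fingroup all_algebra.
From mathcomp Require Import boolp classical_sets reals.
From mathcomp Require Import zify ring lra.

(** The group is handled through two kinds of elements. A swap exchanges two
    disjoint intervals with lengths powers of tau, affinely; the rotation of
    such an interval turns its subdivision by an x-caret into its subdivision by
    a y-caret.

    A nontrivial normal subgroup [N] of the kernel contains all swaps
    ([normal_contains_swaps]). An element of [N] displaces some interval, so
    that commutators of elements supported there are in [N]; this forces the
    swaps of parts of that interval to be congruent modulo [N], then all swaps
    that leave some room free. A swap is the product of the swaps of its halves,
    so it is congruent to the square of an involution.

    Let [monolith] be the intersection of all nontrivial normal subgroups of the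
    kernel. It contains the swaps and is normal in Vtau. Modulo it, all rotations
    are congruent ([rot_cong]), and their squares are trivial ([rot_yl]): the
    subdivision x-caret, then x-caret on the right, is the subdivision y-caret,
    then y-caret on the left. So [swaprot], the union of the monolith and of the
    coset of the rotations, is a subgroup.

    This subgroup is all of Vtau ([Vtau_swaprot]). Given an element, cut its
    source into intervals of lengths t^N and t^(N+1): a number of Z[tau] that is
    positive is a sum of such powers for N large ([Ztau_positive]). Cutting
    further by x-carets, the target also gets two consecutive lengths
    ([straight_refine]). Neighbours of different lengths can be exchanged by a
    rotation, so only the numbers of long and of short intervals matter, and by
    irrationality of tau they are those of a tree of x-carets
    ([straight_tiles]). An element that carries the leaves of one tree of x-carets
    to those of another is a product of swaps, by induction on the number of
    carets ([xtree_matches]): the swaps permute the leaves at will, so one caret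
    can be carried onto one caret.

    Finally phi vanishes on the monolith and is constant on the coset of the
    rotations. As phi is onto, it is not zero on that coset, so the kernel is
    the monolith ([Vxz_monolith]) and has no proper nontrivial normal subgroup. *)

Set Implicit Arguments.
Unset Strict Implicit.
Unset Printing Implicit Defensive.

Import Order.TTheory GRing.Theory Num.Theory.
Local Open Scope ring_scope.

(** * The golden number and its ring of integers *)

Section GoldenNumber.
Variable R : realType.
Local Notation t := (tau R).

Lemma tau_sqr : t ^+ 2 = 1 - t.
Proof.
have h : Num.sqrt 5 ^+ 2 = 5 :> R by rewrite sqr_sqrtr // ler0n.
rewrite /tau; move: h; set s := Num.sqrt 5 => h.
by nra.
Qed.

Lemma tau_bounds : (0 < t) && (t < 1).
Proof.
have h : Num.sqrt 5 ^+ 2 = 5 :> R by rewrite sqr_sqrtr // ler0n.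
have h0 : 0 <= Num.sqrt 5 :> R by exact: sqrtr_ge0.
rewrite /tau; move: h h0; set s := Num.sqrt 5 => h h0.
have h1 : 1 < s by nra.
have h2 : s < 3 by nra.
by apply/andP; split; lra.
Qed.

Lemma tau_gt0 : 0 < t. Proof. by case/andP: tau_bounds. Qed.
Lemma tau_lt1 : t < 1. Proof. by case/andP: tau_bounds. Qed.
Lemma tau_neq0 : t != 0. Proof. by rewrite gt_eqF // tau_gt0. Qed.
Lemma expt_gt0 k : 0 < t ^+ k. Proof. exact/exprn_gt0/tau_gt0. Qed.
Lemma expt_neq0 k : t ^+ k != 0. Proof. by rewrite gt_eqF // expt_gt0. Qed.

Lemma expt_split k : t ^+ k = t ^+ k.+1 + t ^+ k.+2.
Proof. by rewrite !exprS mulrA -expr2 tau_sqr; ring. Qed.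

Lemma expt_le m n : (m <= n)%N -> t ^+ n <= t ^+ m.
Proof.
move=> mn; rewrite -(subnK mn) exprD ler_piMl ?(ltW (expt_gt0 _)) //.
by rewrite exprn_ile1 ?(ltW tau_gt0) ?(ltW tau_lt1).
Qed.

Lemma expt_lt m n : (m < n)%N -> t ^+ n < t ^+ m.
Proof.
move=> mn; apply: (le_lt_trans (expt_le mn)).
by rewrite [ltRHS]expt_split ltrDl expt_gt0.
Qed.

Lemma expt_inj : injective (fun k => t ^+ k).
Proof.
by move=> m n /eqP e; case: (ltngtP m n) => // /expt_lt; rewrite lt_neqAle ?e // eq_sym e.
Qed.

(** Bernoulli's inequality for [1 / t = 1 + t] gives
    [t ^+ k * (1 + k * t) <= 1]. *)
Lemma expt_small (e : R) : 0 < e -> exists k, t ^+ k < e.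
Proof.
move=> e0.
have bern k : t ^+ k * (1 + k%:R * t) <= 1.
  elim: k => [|k IH]; first by rewrite expr0; lra.
  apply: le_trans IH; rewrite exprS -subr_ge0.
  have -> : t ^+ k * (1 + k%:R * t) - t * t ^+ k * (1 + k.+1%:R * t) =
            t ^+ k * (1 + k%:R * t - t - k.+1%:R * t ^+ 2) by ring.
  apply: mulr_ge0; first exact/ltW/expt_gt0.
  rewrite tau_sqr -natr1.
  have -> : 1 + k%:R * t - t - (k%:R + 1) * (1 - t) = k%:R * (t + t - 1) :> R by ring.
  apply: mulr_ge0 => //; have := tau_sqr; have := tau_gt0; have := tau_lt1; nra.
have [k kP] : exists k : nat, e^-1 * t^-1 < k%:R.
  exists (Num.bound (e^-1 * t^-1)); apply: archi_boundP.
  by rewrite mulr_ge0 // invr_ge0 ltW // tau_gt0.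
exists k; have kt : e^-1 < k%:R * t by rewrite -ltr_pdivrMr ?tau_gt0.
have B := bern k; have p0 := expt_gt0 k.
have ee : e^-1 * e = 1 by rewrite mulVf // gt_eqF.
have i0 : 0 < e^-1 by rewrite invr_gt0.
rewrite ltNge; apply/negP => le.
have : t ^+ k * (k%:R * t) > 1.
  rewrite -[ltLHS]ee [e^-1 * e]mulrC; apply: le_lt_trans (_ : t ^+ k * e^-1 < _).
    by rewrite ler_pM2r.
  by rewrite ltr_pM2l.
by move: B p0; rewrite mulrDr mulr1; lra.
Qed.

Lemma ZtauP x : Ztau x <-> exists m n : int, x = m%:~R + n%:~R * t.
Proof.
split=> [[p ->]|[m [n ->]]].
  elim/poly_ind: p => [|p c [m [n IH]]].
    by exists 0, 0; rewrite rmorph0 horner0; ring.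
  exists (c + n), (m - n).
  rewrite rmorphD rmorphM /= map_polyX map_polyC /= hornerMXaddC IH.
  have -> : (m%:~R + n%:~R * t) * t = m%:~R * t + n%:~R * t ^+ 2 :> R by ring.
  by rewrite tau_sqr !(rmorphD, rmorphB) /=; ring.
exists (m%:P + n%:P * 'X).
by rewrite rmorphD rmorphM /= map_polyX !map_polyC /= !hornerE.
Qed.

Lemma Ztau0 : Ztau (0 : R). Proof. by apply/ZtauP; exists 0, 0; ring. Qed.
Lemma Ztau1 : Ztau (1 : R). Proof. by apply/ZtauP; exists 1, 0; ring. Qed.
Lemma ZtauB (x y : R) : Ztau x -> Ztau y -> Ztau (x - y).
Proof.
move=> /ZtauP[m [n ->]] /ZtauP[p [q ->]]; apply/ZtauP; exists (m - p), (n - q).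
by rewrite !rmorphB /=; ring.
Qed.
Lemma ZtauD (x y : R) : Ztau x -> Ztau y -> Ztau (x + y).
Proof.
move=> Zx Zy; rewrite -[y]opprK -[- y]sub0r; apply: ZtauB => //.
exact: ZtauB Ztau0 Zy.
Qed.
Lemma ZtauM (x y : R) : Ztau x -> Ztau y -> Ztau (x * y).
Proof. by move=> [p ->] [q ->]; exists (p * q); rewrite rmorphM hornerM. Qed.
Lemma Ztau_expt k : Ztau (t ^+ k).
Proof. by exists 'X^k; rewrite map_polyXn hornerXn. Qed.

Lemma tau_inv : t^-1 = 1 + t.
Proof.
apply: (mulfI tau_neq0); rewrite divff ?tau_neq0 // mulrDr -expr2 tau_sqr; ring.
Qed.

Lemma Ztau_exprz (k : int) : Ztau (t ^ k).
Proof.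
case: k => n; first exact: Ztau_expt.
rewrite NegzE -exprz_inv -exprnP tau_inv; elim: n.+1 => [|m IH]; first exact: Ztau1.
by rewrite exprS; apply: ZtauM IH; apply: ZtauD Ztau1 _; apply: (Ztau_expt 1).
Qed.

(** The exponent of 5 would be even on the left and odd on the right. *)
Lemma sqr_neq_5sqr (m n : nat) : (m ^ 2 = 5 * n ^ 2 -> n = 0)%N.
Proof.
move=> e; case: (posnP n) => // n0.
have m0 : (0 < m)%N.
  rewrite lt0n; apply/eqP => m0; move: e; rewrite m0 => /esym/eqP.
  by rewrite muln_eq0 /= expn_eq0 /=; lia.
move: (congr1 (logn 5) e); rewrite lognM ?expn_gt0 ?n0 // !lognX (@logn_prime 5 5) //=.
by lia.
Qed.

Lemma tau_irrational (m n : int) : m%:~R + n%:~R * t = 0 :> R -> m = 0 /\ n = 0.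
Proof.
move=> e.
have h : Num.sqrt 5 ^+ 2 = 5 :> R by rewrite sqr_sqrtr // ler0n.
have e1 : ((n - 2 * m) ^+ 2)%:~R = (5 * n ^+ 2)%:~R :> R.
  rewrite !(rmorphXn, rmorphM, rmorphB) /=.
  have -> : 5%:~R = Num.sqrt 5 ^+ 2 :> R by rewrite h.
  rewrite -exprMn.
  congr (_ ^+ 2); move: e; rewrite /tau; lra.
move/intr_inj: e1 => e1.
move: e1; set u := n - 2 * m => e1.
have : (`|u| ^ 2 = 5 * `|n| ^ 2)%N by move: e1; clear; nia.
move/sqr_neq_5sqr => n0; have {}n0 : n = 0 by lia.
by move: e; rewrite n0 mul0r addr0 => /eqP; rewrite intr_eq0 => /eqP.
Qed.

(** Rewriting [t ^+ k] as [t ^+ k.+1 + t ^+ k.+2] turns the coordinates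
    [(m, n)] into [(m + n, m)]. If [m] and [n] have mixed signs and the number is
    positive, the new coordinates are nonnegative or the sum [`|m| + `|n|] has
    strictly decreased. *)
Lemma Ztau_positive_at (k : nat) (m n : int) :
  0 < m%:~R * t ^+ k + n%:~R * t ^+ k.+1 :> R ->
  exists N p q : nat, m%:~R * t ^+ k + n%:~R * t ^+ k.+1 = p%:R * t ^+ N + q%:R * t ^+ N.+1 :> R.
Proof.
have [b] := ubnP (`|m| + `|n|)%N; elim: b k m n => // b IH k m n bP pos.
have [/andP[m0 n0]|mix] := boolP ((0 <= m) && (0 <= n)).
  by exists k, `|m|%N, `|n|%N; rewrite !natr_absz !ger0_norm.
have eS : m%:~R * t ^+ k + n%:~R * t ^+ k.+1 =
    (m + n)%:~R * t ^+ k.+1 + m%:~R * t ^+ k.+2 :> R.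
  by rewrite [t ^+ k]expt_split rmorphD /=; ring.
have nonpos (u v : int) i : u <= 0 -> v <= 0 -> u%:~R * t ^+ i + v%:~R * t ^+ i.+1 <= 0 :> R.
  move=> u0 v0; rewrite -[0]addr0; apply: lerD; apply: mulr_le0_ge0;
  by rewrite ?lerz0 // ltW // expt_gt0.
have c1 : ~ (m <= 0 /\ n <= 0).
  by move=> [u0 v0]; have := nonpos _ _ k u0 v0; lra.
have c2 : ~ (m + n <= 0 /\ m <= 0).
  by move=> [u0 v0]; have := nonpos _ _ k.+1 u0 v0; lra.
have [/andP[m0 n0]|mix'] := boolP ((0 <= m) && (0 <= m + n)).
  by rewrite eS; exists k.+1, `|(m + n)%R|%N, `|m|%N; rewrite !natr_absz !ger0_norm.
rewrite eS; apply: IH; last by rewrite -eS.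
by move: bP mix mix' c1 c2; clear; lia.
Qed.

Lemma level_up (N p q : nat) : exists p' q' : nat,
  p%:R * t ^+ N + q%:R * t ^+ N.+1 = p'%:R * t ^+ N.+1 + q'%:R * t ^+ N.+2 :> R.
Proof. by exists (p + q)%N, p; rewrite [t ^+ N]expt_split natrD; ring. Qed.

Lemma Ztau_positive (x : R) : Ztau x -> 0 < x ->
  exists N, forall N', (N <= N')%N ->
  exists p q : nat, x = p%:R * t ^+ N' + q%:R * t ^+ N'.+1.
Proof.
move=> /ZtauP[m [n xE]] x0.
have xE' : x = m%:~R * t ^+ 0 + n%:~R * t ^+ 1 by rewrite xE expr0 expr1 mulr1.
have [N [p [q e]]] : exists N p q : nat, x = p%:R * t ^+ N + q%:R * t ^+ N.+1.
  by move: x0; rewrite xE'; apply: Ztau_positive_at.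
exists N => N' /subnK <-; elim: (N' - N)%N => [|d [p' [q' IH]]]; first by exists p, q.
by rewrite IH; apply: level_up.
Qed.

End GoldenNumber.

(** * Piecewise affine maps given by finite covers *)

Section Pieces.
Variable R : realType.
Local Notation t := (tau R).
Local Notation I01 := (I01 R).
Implicit Types (f g : I01 -> I01) (p q : (R * R) * (int * R)).

Definition affine_piece f p :=
  forall x : I01, p.1.1 < val x <= p.1.2 -> val (f x) = t ^ p.2.1 * val x + p.2.2.

Definition golden_piece p :=
  [/\ Ztau p.1.1, Ztau p.1.2, Ztau p.2.2, 0 <= p.1.1 & p.1.2 <= 1].

(** The pieces cover the interval but may overlap. This makes composition and
    inversion a matter of intersecting pieces, without a common refinement. *)
Definition pieced f := exists s : seq ((R * R) * (int * R)),
  (forall p, p \in s -> golden_piece p /\ affine_piece f p) /\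
  forall x : I01, exists2 p, p \in s & p.1.1 < val x <= p.1.2.

Lemma exptz_gt0 (k : int) : 0 < t ^ k.
Proof. by rewrite exprz_gt0 // tau_gt0. Qed.

Lemma exptzNK (k : int) (y : R) : t ^ k * (t ^ (- k) * y) = y.
Proof. by rewrite mulrA -expfzDr ?tau_neq0 // subrr expr0z mul1r. Qed.

Lemma Ztau_max (x y : R) : Ztau x -> Ztau y -> Ztau (Num.max x y).
Proof. by case: leP. Qed.
Lemma Ztau_min (x y : R) : Ztau x -> Ztau y -> Ztau (Num.min x y).
Proof. by case: leP. Qed.

Lemma ltr_expz_divl (k : int) (x y : R) : (t ^ (- k) * y < x) = (y < t ^ k * x).
Proof. by rewrite -(ltr_pM2l (exptz_gt0 k)) exptzNK. Qed.
Lemma ler_expz_divr (k : int) (x y : R) : (x <= t ^ (- k) * y) = (t ^ k * x <= y).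
Proof. by rewrite -(ler_pM2l (exptz_gt0 k)) exptzNK. Qed.

Definition comp_piece q p : (R * R) * (int * R) :=
  ((Num.max p.1.1 (t ^ (- p.2.1) * (q.1.1 - p.2.2)),
    Num.min p.1.2 (t ^ (- p.2.1) * (q.1.2 - p.2.2))),
   (q.2.1 + p.2.1, t ^ q.2.1 * p.2.2 + q.2.2)).

Lemma pieced_comp f g : pieced f -> pieced g -> pieced (f \o g).
Proof.
move=> [s [sP sC]] [u [uP uC]].
exists [seq comp_piece q p | q <- s, p <- u]; split; last first.
  move=> x; have [p pu px] := uC x; have [q qs qx] := sC (g x).
  exists (comp_piece q p); first by apply/allpairsP; exists (q, p).
  have [_ /(_ x px) gx] := uP p pu.
  move: px qx; rewrite gx /= gt_max le_min ltr_expz_divl ler_expz_divr.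
  by move=> /andP[-> ->] /andP[u1 u2] /=; rewrite ltrBlDr lerBrDr u1 u2.
move=> r /allpairsP[[q p] /= [qs pu ->]].
have [[Z1 Z2 Z3 ge0 le1] gP] := uP p pu.
have [[Z4 Z5 Z6 _ _] fP] := sP q qs.
have Zt k y : Ztau y -> Ztau (t ^ k * y) by apply: ZtauM; exact: Ztau_exprz.
split.
  split=> /=; rewrite ?le_max ?ge_min ?ge0 ?le1 //.
  - by apply: Ztau_max => //; apply/Zt/ZtauB.
  - by apply: Ztau_min => //; apply/Zt/ZtauB.
  - by apply: ZtauD => //; apply: Zt.
move=> x /=; rewrite gt_max le_min ltr_expz_divl ler_expz_divr ltrBlDr lerBrDr.
move=> /andP[/andP[h1 h2] /andP[h3 h4]].
have gx := gP x; rewrite h1 h3 in gx; have {}gx := gx erefl.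
rewrite fP; last by rewrite gx h2 h4.
by rewrite gx expfzDr ?tau_neq0 // mulrDr !mulrA addrA.
Qed.

(** The image of a piece, truncated to [0, 1] so that it is a piece again. *)
Definition inv_piece p : (R * R) * (int * R) :=
  ((Num.max 0 (t ^ p.2.1 * p.1.1 + p.2.2), Num.min 1 (t ^ p.2.1 * p.1.2 + p.2.2)),
   (- p.2.1, - (t ^ (- p.2.1) * p.2.2))).

Lemma pieced_inv f g : cancel f g -> cancel g f -> pieced f -> pieced g.
Proof.
move=> fK gK [s [sP sC]]; exists [seq inv_piece p | p <- s]; split; last first.
  move=> y; have [p ps pgy] := sC (g y).
  exists (inv_piece p); first exact: map_f.
  have [_ /(_ _ pgy)] := sP p ps; rewrite gK /= => yE.
  rewrite gt_max le_min; have /andP[-> ->] /= := valP y.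
  by rewrite yE ltrD2r lerD2r ltr_pM2l ?ler_pM2l ?exptz_gt0.
move=> _ /mapP[p ps ->].
have [[Z1 Z2 Z3 ge0 le1] fP] := sP p ps.
have Zt k y : Ztau y -> Ztau (t ^ k * y) by apply: ZtauM; exact: Ztau_exprz.
split.
  split=> /=; rewrite ?le_max ?ge_min ?lexx //.
  - by apply: Ztau_max (Ztau0 R) _; apply: ZtauD => //; apply: Zt.
  - by apply: Ztau_min (Ztau1 R) _; apply: ZtauD => //; apply: Zt.
  - by rewrite -sub0r; apply: ZtauB (Ztau0 R) (Zt _ _ Z3).
move=> y /=; rewrite gt_max le_min -ltrBrDr -lerBlDr.
rewrite -[val y - _](exptzNK p.2.1).
rewrite ltr_pM2l ?ler_pM2l ?exptz_gt0 //.
set x := t ^ (- p.2.1) * (val y - p.2.2) => /andP[/andP[_ h1] /andP[_ h2]].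
have xI : 0 < x <= 1 by rewrite (le_lt_trans ge0 h1) (le_trans h2 le1).
have fx : f (Sub x xI) = y.
  apply: val_inj; rewrite fP SubK ?h1 //.
  by rewrite exptzNK subrK.
by rewrite -fx fK SubK fx /x mulrBr.
Qed.

Lemma affine_piece_dist f p (x y : I01) : affine_piece f p ->
  p.1.1 < val x <= p.1.2 -> p.1.1 < val y <= p.1.2 ->
  val (f y) - val (f x) = t ^ p.2.1 * (val y - val x).
Proof. by move=> fP px py; rewrite !fP //; ring. Qed.

Lemma pieced_Vtau (f : bijection I01) : pieced f -> Vtau f.
Proof.
move=> [s [sP sC]]; split.
  move=> x e e0; have [p ps px] := sC x; have [_ fP] := sP p ps.
  set d := Num.min (val x - p.1.1) (t ^ (- p.2.1) * e).
  exists d.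
    case/andP: px => px _; rewrite /d lt_min subr_gt0 px /=.
    by rewrite mulr_gt0 // exptz_gt0.
  move=> y /andP[y1 y2].
  have [d1 d2] : val x - val y < val x - p.1.1 /\ val x - val y < t ^ (- p.2.1) * e.
    by apply/andP; rewrite -lt_min -/d; lra.
  have py : p.1.1 < val y <= p.1.2 by case/andP: px => px1 px2; apply/andP; split; lra.
  rewrite (affine_piece_dist fP px py) ler0_norm; last first.
    by apply: mulr_ge0_le0; [exact/ltW/exptz_gt0 | lra].
  by rewrite -mulrN opprB -[e](exptzNK p.2.1) ltr_pM2l ?exptz_gt0.
(* No end point of a piece lies strictly between two neighbours in the sorted
   list of all end points, so a single piece covers each gap. *)
pose E := 0 :: 1 :: [seq p.1.1 | p <- s & p.1.1 < 1] ++ [seq p.1.2 | p <- s & 0 < p.1.2].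
pose B := sort <=%R (undup E).
have memB y : (y \in B) = (y \in E) by rewrite mem_sort mem_undup.
have EZ y : y \in E -> [/\ Ztau y, 0 <= y & y <= 1].
  rewrite !inE mem_cat => /or4P[/eqP->|/eqP->|/mapP[p]|/mapP[p]].
  - by split=> //; exact: Ztau0.
  - by split=> //; exact: Ztau1.
  - by rewrite mem_filter => /andP[l1 ps] ->; have [[? _ _ ? _] _] := sP p ps; split=> //; exact: ltW.
  - by rewrite mem_filter => /andP[l1 ps] ->; have [[_ ? _ _ ?] _] := sP p ps; split=> //; exact: ltW.
have sB : sorted <%R B by rewrite sort_lt_sorted undup_uniq.
have sB' : sorted <=%R B by apply: sub_sorted sB => ? ?; exact: ltW.
have B0 : 0 \in B by rewrite memB inE eqxx.
have B1 : 1 \in B by rewrite memB !inE eqxx orbT.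
have sz0 : (0 < size B)%N by case: B B0 {memB sB sB' B1}.
have nthB i : (i < size B)%N -> [/\ Ztau B`_i, 0 <= B`_i & B`_i <= 1].
  by move=> iB; apply: EZ; rewrite -memB mem_nth.
have mono i j : (i <= j)%N -> (j < size B)%N -> B`_i <= B`_j.
  move=> ij jB; apply: sorted_leq_nth => //; first exact: le_trans.
  by rewrite inE; apply: leq_ltn_trans jB.
have smono i j : (i < j)%N -> (j < size B)%N -> B`_i < B`_j.
  move=> ij jB; apply: sorted_ltn_nth => //; first exact: lt_trans.
  by rewrite inE; apply: ltn_trans jB.
exists (size B).-1, (fun i => B`_i); split.
- split.
    apply/eqP; rewrite eq_le; have [_ -> _] := nthB 0%N sz0; rewrite andbT.
    by rewrite -[X in _ <= X](nth_index 0 B0); apply: mono; rewrite ?index_mem.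
  apply/eqP; rewrite eq_le; have [|_ _ ->] /= := nthB (size B).-1; first by rewrite prednK.
  rewrite -[X in X <= _](nth_index 0 B1); apply: mono; last by rewrite prednK.
  by rewrite -ltnS prednK // index_mem.
- by move=> i iB; apply: smono => //; rewrite -ltn_predRL.
- by move=> i iB; have [|] := nthB i; rewrite // -(prednK sz0) ltnS.
move=> i iB; have iB1 : (i.+1 < size B)%N by rewrite -ltn_predRL.
have iB0 : (i < size B)%N by apply: ltnW.
have yI : 0 < B`_i.+1 <= 1.
  have [_ _ ->] := nthB _ iB1; have [_ ge0 _] := nthB _ iB0.
  by rewrite andbT; apply: le_lt_trans ge0 (smono _ _ _ _).
have [p ps] := sC (Sub (B`_i.+1) yI); rewrite SubK => /andP[p1 p2].
exists p.2.1, p.2.2 => x /andP[x1 x2].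
have [_ fP] := sP p ps; apply: fP; rewrite (le_trans (ltW x2) p2) andbT.
apply: le_lt_trans x1.
have p1B : p.1.1 \in B.
  have pl1 : p.1.1 < 1 by apply: lt_le_trans p1 _; case/andP: yI.
  rewrite memB !inE mem_cat (_ : p.1.1 \in map _ _) ?orbT //.
  by apply: (map_f (fun p => p.1.1)); rewrite mem_filter pl1.
rewrite leNgt; apply/negP => lt1.
move: p1B => /(nthP 0)[j jB jE]; rewrite -jE in p1 lt1.
have [le|lt] := leqP j i.
  by have := mono _ _ le iB0; rewrite leNgt lt1.
by have := mono _ _ lt jB; rewrite leNgt p1.
Qed.

End Pieces.

(** * Break points of an element of Vtau *)

Section Chains.
Variable R : realType.
Local Notation t := (tau R).
Local Notation I01 := (I01 R).

Lemma left_continuous_affine (f : I01 -> I01) (a b c : R) (k : int) :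
  left_continuous f -> 0 <= a -> b <= 1 ->
  (forall x : I01, a < val x < b -> val (f x) = t ^ k * val x + c) ->
  affine_piece f ((a, b), (k, c)).
Proof.
move=> lc a0 b1 fE x; rewrite -[_.1.1]/a -[_.1.2]/b -[_.2.1]/k -[_.2.2]/c => /andP[ax].
rewrite le_eqVlt => /predU1P[xb|xb]; last first.
  by apply: fE; rewrite ax.
apply/eqP; rewrite -subr_eq0 -normr_eq0; apply: contraT => D0.
set D := `|_| in D0; have {}D0 : 0 < D by rewrite lt_def D0 normr_ge0.
have tk := exptz_gt0 R k.
have [d d0 dP] := lc x (D / 2) (divr_gt0 D0 (ltr0Sn _ _)).
have e0 : 0 < t ^ (- k) * (D / 2) by rewrite mulr_gt0 ?exptz_gt0 // divr_gt0.
pose w := Num.min (val x - a) (Num.min d (t ^ (- k) * (D / 2))).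
have [w0 w1 w2 w3] : [/\ 0 < w, w <= val x - a, w <= d & w <= t ^ (- k) * (D / 2)].
  rewrite /w !ge_min !lexx !orbT; split=> //.
  by rewrite !lt_min subr_gt0 ax d0 e0.
have /andP[x0 x1] := valP x.
have yI : 0 < val x - w / 2 <= 1 by apply/andP; split; lra.
pose y : I01 := Sub (val x - w / 2) yI.
have yE : val y = val x - w / 2 by rewrite SubK.
have h1 : `|val (f y) - val (f x)| < D / 2 by apply: dP; rewrite yE; apply/andP; split; lra.
have h2 : t ^ k * (w / 2) < D / 2.
  rewrite -[X in _ < X](exptzNK k) ltr_pM2l //; lra.
have h3 : val (f y) = t ^ k * (val x - w / 2) + c.
  by rewrite -yE; apply: fE; rewrite yE -xb; apply/andP; split; lra.
have h4 : 0 < t ^ k * (w / 2) by rewrite mulr_gt0 // divr_gt0.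
suff : D < D by rewrite ltxx.
rewrite {1}/D.
have -> : \val (f x) - (t ^ k * \val x + c) =
   - (val (f y) - val (f x)) - t ^ k * (w / 2) by rewrite h3; ring.
apply: le_lt_trans (ler_normB _ _) _; rewrite normrN (gtr0_norm h4); lra.
Qed.

(** A negative left end of the image would give the points just to the right of
    [a] negative images. *)
Lemma affine_image_ge0 (f : I01 -> I01) (a b c : R) (k : int) :
  0 <= a -> a < b -> b <= 1 -> affine_piece f ((a, b), (k, c)) -> 0 <= t ^ k * a + c.
Proof.
move=> a0 ab b1 fP; rewrite leNgt; apply/negP => lt0.
pose w := Num.min (b - a) (t ^ (- k) * - (t ^ k * a + c)).
have w0 : 0 < w by rewrite lt_min subr_gt0 ab //= mulr_gt0 ?exptz_gt0 // oppr_gt0.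
have [w1 w2] : w <= b - a /\ w <= t ^ (- k) * - (t ^ k * a + c).
  by rewrite !ge_min !lexx orbT.
have xI : 0 < a + w <= 1 by apply/andP; split; lra.
have /andP[+ _] := valP (f (Sub (a + w) xI)).
rewrite fP // SubK /=; last by apply/andP; split; lra.
apply/negP; rewrite -leNgt.
have : t ^ k * w <= - (t ^ k * a + c) by rewrite -ler_expz_divr.
set T := t ^ k; nra.
Qed.

Definition chain_for (f : I01 -> I01) n (a : nat -> R) (k : nat -> int) (c : nat -> R) :=
  [/\ a 0%N = 0, a n = 1, forall i, (i < n)%N -> a i < a i.+1,
      forall i, (i <= n)%N -> Ztau (a i) &
      forall i, (i < n)%N -> Ztau (c i) /\ affine_piece f ((a i, a i.+1), (k i, c i))].

Lemma chain_mono n (a : nat -> R) : (forall i, (i < n)%N -> a i < a i.+1) ->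
  forall i j, (i <= j <= n)%N -> a i <= a j.
Proof.
move=> aS i j /andP[/subnK <-]; elim: (j - i)%N => [|d IH] //= dn.
by apply: le_trans (IH (ltnW dn)) (ltW (aS _ dn)).
Qed.

Lemma chain_find n (a : nat -> R) (x : R) : a 0%N < x -> x <= a n ->
  exists2 i, (i < n)%N & a i < x <= a i.+1.
Proof.
elim: n => [|n IH] a0 xn; first by move: (lt_le_trans a0 xn); rewrite ltxx.
have [xan|axn] := leP x (a n); last by exists n; rewrite // axn.
by have [i iN xi] := IH a0 xan; exists i => //; apply: ltnW.
Qed.

(** The images of the pieces tile (0, 1], and the length of each of them is in
    [Ztau]. Hence the left end of an image is 0 or the right end of an image
    further to the left: all ends are in [Ztau], by induction on the position. *)
Lemma chain_image_golden (f : bijection I01) n (a : nat -> R) (k : nat -> int) (c : nat -> R) :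
  a 0%N = 0 -> a n = 1 -> (forall i, (i < n)%N -> a i < a i.+1) ->
  (forall i, (i <= n)%N -> Ztau (a i)) ->
  (forall i, (i < n)%N -> affine_piece f ((a i, a i.+1), (k i, c i))) ->
  forall i, (i < n)%N -> Ztau (c i).
Proof.
move=> a0 an aS Za fP.
have am := chain_mono aS.
have a01 i : (i <= n)%N -> 0 <= a i <= 1.
  by move=> iN; rewrite -{1}a0 -an !am // ?iN ?leqnn.
pose l i := t ^ k i * a i + c i.
pose r i := t ^ k i * a i.+1 + c i.
have lr i : (i < n)%N -> l i < r i.
  by move=> iN; rewrite /l /r ltrD2r ltr_pM2l ?exptz_gt0 ?aS.
have back (y : I01) i : (i < n)%N -> l i < val y <= r i ->
    exists2 x, f x = y & a i < val x <= a i.+1.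
  move=> iN; rewrite /l /r -ltrBrDr -lerBlDr.
  rewrite -[val y - _](exptzNK (k i)) ltr_pM2l ?ler_pM2l ?exptz_gt0 //.
  move=> ayi; set x := t ^ _ * _ in ayi; have xI : 0 < x <= 1.
    have /andP[h _] := a01 i (ltnW iN); have /andP[_ h'] := a01 i.+1 iN.
    by case/andP: ayi => u v; rewrite (le_lt_trans h u) (le_trans v h').
  exists (Sub x xI); last by rewrite SubK.
  by apply: val_inj; rewrite (fP i) // SubK /= /x exptzNK subrK.
have l0 i : (i < n)%N -> 0 <= l i.
  move=> iN; have /andP[ai _] := a01 i (ltnW iN); have /andP[_ ai'] := a01 i.+1 iN.
  exact: affine_image_ge0 ai (aS i iN) ai' (fP i iN).
have r1 i : (i < n)%N -> r i <= 1.
  move=> iN; have /andP[ai _] := a01 i (ltnW iN); have /andP[_ ai'] := a01 i.+1 iN.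
  have xI : 0 < a i.+1 <= 1 by rewrite ai' (le_lt_trans ai) ?aS.
  have /andP[_] := valP (f (Sub (a i.+1) xI)).
  by rewrite (fP i) // SubK /= lexx aS.
have inj i j x : (i < n)%N -> (j < n)%N -> a i < x <= a i.+1 -> a j < x <= a j.+1 -> i = j.
  move=> iN jN /andP[i1 i2] /andP[j1 j2]; case: (ltngtP i j) => // ij.
    have := am i.+1 j; rewrite ij (ltnW jN) => /(_ erefl) h.
    by move: (lt_le_trans j1 (le_trans i2 h)); rewrite ltxx.
  have := am j.+1 i; rewrite ij (ltnW iN) => /(_ erefl) h.
  by move: (lt_le_trans i1 (le_trans j2 h)); rewrite ltxx.
suff Zl i : (i < n)%N -> Ztau (l i).
  move=> i iN; have -> : c i = l i - t ^ k i * a i by rewrite /l; ring.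
  by apply: ZtauB (Zl i iN) (ZtauM (Ztau_exprz _ _) (Za i (ltnW iN))).
pose below i := #|[set j : 'I_n | l j < l i]|.
have [b] := ubnP (below i); elim: b i => // b IH i ib iN.
have [l00|l00] := eqVneq (l i) 0; first by rewrite l00; exact: Ztau0.
have yI : 0 < l i <= 1.
  by rewrite lt_def l00 l0 //= (le_trans (ltW (lr i iN))) ?r1.
have [x fx] : exists x, f x = Sub (l i) yI by exists (bij_inv f (Sub (l i) yI)); rewrite bij_invK.
have [j jN jx] : exists2 j, (j < n)%N & a j < val x <= a j.+1.
  by case/andP: (valP x) => x0 x1; apply: chain_find; rewrite ?a0 ?an.
have := fP j jN x jx; rewrite fx SubK /= => lE.
have lj : l j < l i by rewrite lE /l ltrD2r ltr_pM2l ?exptz_gt0; case/andP: jx.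
have rj : l i <= r j by rewrite lE /r lerD2r ler_pM2l ?exptz_gt0; case/andP: jx.
have Zlj : Ztau (l j).
  apply: IH => //; rewrite -ltnS; apply: leq_trans ib; rewrite ltnS.
  apply: proper_card; apply/properP; split.
    by apply/fintype.subsetP => m; rewrite !inE => /lt_trans; apply.
  by exists (Ordinal jN); rewrite !inE //= ltxx.
move: rj; rewrite le_eqVlt => /predU1P[->|rj].
  have -> : r j = l j + t ^ k j * (a j.+1 - a j) by rewrite /r /l; ring.
  by apply: ZtauD Zlj (ZtauM (Ztau_exprz _ _) (ZtauB (Za _ jN) (Za _ (ltnW jN)))).
(* Otherwise the images of the pieces i and j would overlap. *)
pose z := Num.min (r i) (r j).
have [z1 z2 z3] : [/\ l i < z, z <= r i & z <= r j].
  by rewrite /z lt_min lr //= rj !ge_min !lexx orbT.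
have zI : 0 < z <= 1.
  by rewrite (le_lt_trans (l0 i iN) z1) (le_trans z2 (r1 i iN)).
have [|x1 f1 p1] := back (Sub z zI) i iN; first by rewrite SubK z1.
have [|x2 f2 p2] := back (Sub z zI) j jN; first by rewrite SubK (lt_trans lj z1).
have x12 : x1 = x2 by apply: (can_inj (bij_funK f)); rewrite f1 f2.
by rewrite x12 in p1; move: lj; rewrite (inj _ _ _ iN jN p1 p2) ltxx.
Qed.

Lemma Vtau_chain (f : bijection I01) : Vtau f -> exists n a k c, chain_for f n a k c.
Proof.
move=> [lc [n [a [[a0 an] aS Za aff]]]].
have am := chain_mono aS.
have /choice[kc kcP] : forall i, exists kc : int * R, (i < n)%N ->
    affine_piece f ((a i, a i.+1), kc).
  move=> i; have [iN|] := boolP (i < n)%N; last by exists (0, 0).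
  have [k [c kcP]] := aff i iN; exists (k, c) => _.
  by apply: left_continuous_affine => //; rewrite -?a0 -?an am // ?leq0n ?iN ?leqnn //; apply: ltnW.
exists n, a, (fun i => (kc i).1), (fun i => (kc i).2).
have kcP' i : (i < n)%N -> affine_piece f ((a i, a i.+1), ((kc i).1, (kc i).2)).
  by move=> iN; have := kcP i iN; case: (kc i).
split=> // i iN; split; last exact: kcP'.
exact: (chain_image_golden a0 an aS Za kcP').
Qed.

Lemma Vtau_pieced (f : bijection I01) : Vtau f -> pieced f.
Proof.
move=> /Vtau_chain[n [a [k [c [a0 an aS Za P]]]]].
have am := chain_mono aS.
exists [seq ((a i, a i.+1), (k i, c i)) | i <- iota 0 n]; split.
  move=> _ /mapP[i + ->]; rewrite mem_iota => /= iN; have [Zc fP] := P i iN.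
  split=> //; split=> //=; [exact/Za/ltnW | exact: Za | rewrite -a0 | rewrite -an];
    by apply: am; rewrite // ?iN ?leqnn //= ltnW.
move=> x; have [||i iN xi] := @chain_find n a (val x).
- by rewrite a0; case/andP: (valP x).
- by rewrite an; case/andP: (valP x).
exists ((a i, a i.+1), (k i, c i)) => //.
by apply/mapP; exists i; rewrite ?mem_iota.
Qed.

Lemma VtauM (f g : bijection I01) : Vtau f -> Vtau g -> Vtau (f * g)%g.
Proof.
by move=> /Vtau_pieced Vf /Vtau_pieced Vg; apply: pieced_Vtau; exact: pieced_comp.
Qed.

Lemma VtauV (f : bijection I01) : Vtau f -> Vtau (f^-1)%g.
Proof.
move=> /Vtau_pieced Vf; apply: pieced_Vtau.
exact: pieced_inv (bij_funK f) (bij_invK f) Vf.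
Qed.

Lemma Vtau1 : Vtau (1%g : bijection I01).
Proof.
apply: pieced_Vtau; exists [:: ((0, 1), (0, 0))]; split; last first.
  by move=> x; exists ((0, 1), (0, 0)); [rewrite inE | exact: valP x].
move=> p; rewrite inE => /eqP ->; split.
  by split=> //=; [exact: Ztau0 | exact: Ztau1 | exact: Ztau0].
by move=> x _ /=; rewrite expr0z mul1r addr0.
Qed.

End Chains.

(** * Golden intervals *)

Section Intervals.
Variable R : realType.
Local Notation t := (tau R).
Local Notation I01 := (I01 R).

(** The pair [(a, k)] stands for the interval from [a], excluded, to
    [a + t ^+ k], included. Restricting the lengths to powers of [t] makes all
    the intervals similar, with ratios that are allowed as slopes. *)
Definition itv : Type := (R * nat)%type.
Implicit Types (I J K L A B C D : itv) (f g h : bijection I01).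

Definition in_itv I (x : R) : bool := (I.1 < x) && (x <= I.1 + t ^+ I.2).
Definition golden I := [/\ Ztau I.1, 0 <= I.1 & I.1 + t ^+ I.2 <= 1].
Definition disj I J : bool := (I.1 + t ^+ I.2 <= J.1) || (J.1 + t ^+ J.2 <= I.1).
Definition sub_itv I J : bool := (J.1 <= I.1) && (I.1 + t ^+ I.2 <= J.1 + t ^+ J.2).
Definition aff I J (x : R) : R := J.1 + t ^+ J.2 / t ^+ I.2 * (x - I.1).
Definition maps f I J := forall x : I01, in_itv I (sval x) -> sval (f x) = aff I J (sval x).

Definition point (x : R) (x01 : 0 < x <= 1) : I01 := exist (fun x => is_true (0 < x <= 1)) x x01.

Lemma svalP (x : I01) : 0 < sval x <= 1. Proof. exact: (valP x). Qed.

Lemma in_golden I x : golden I -> in_itv I x -> 0 < x <= 1.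
Proof. by move=> [_ ? ?] /andP[? ?]; apply/andP; split; lra. Qed.

Lemma aff_aff I J K x : aff J K (aff I J x) = aff I K x.
Proof. by rewrite /aff; field; rewrite !expt_neq0. Qed.

Lemma aff_id I x : aff I I x = x.
Proof. by rewrite /aff; field; rewrite !expt_neq0. Qed.

Lemma aff_in I J x : in_itv I x -> in_itv J (aff I J x).
Proof.
rewrite /in_itv /aff => /andP[x1 x2]; have I0 := expt_gt0 R I.2; have J0 := expt_gt0 R J.2.
rewrite ltrDl mulr_gt0 ?subr_gt0 ?divr_gt0 //= lerD2l -mulrA ger_pMr //.
by rewrite ler_pdivrMl // mulr1 lerBlDl.
Qed.

Lemma disj_sym I J : disj I J = disj J I. Proof. exact: orbC. Qed.

Lemma disj_in I J x : disj I J -> in_itv I x -> in_itv J x = false.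
Proof.
rewrite /disj /in_itv => /orP d /andP[x1 x2]; apply/negP => /andP[y1 y2].
by case: d => d; lra.
Qed.

Lemma disjP I J : reflect (forall x, in_itv I x -> in_itv J x = false) (disj I J).
Proof.
apply: (iffP idP) => [d x|d]; first exact: disj_in.
rewrite /disj; case: leP => //= h1; case: leP => //= h2.
have I0 := expt_gt0 R I.2; have J0 := expt_gt0 R J.2.
pose m := Num.min (I.1 + t ^+ I.2) (J.1 + t ^+ J.2).
have [m1 m2] : m <= I.1 + t ^+ I.2 /\ m <= J.1 + t ^+ J.2 by rewrite !ge_min !lexx orbT.
have [m3 m4] : I.1 < m /\ J.1 < m by rewrite !lt_min; split; apply/andP; split; lra.
by have := d m; rewrite /in_itv m1 m2 m3 m4 => /(_ erefl).
Qed.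

Lemma sub_in I J x : sub_itv I J -> in_itv I x -> in_itv J x.
Proof. by move=> /andP[? ?] /andP[? ?]; apply/andP; split; lra. Qed.

Lemma sub_refl I : sub_itv I I. Proof. by rewrite /sub_itv !lexx. Qed.

Lemma sub_trans I J K : sub_itv I J -> sub_itv J K -> sub_itv I K.
Proof. by move=> /andP[? ?] /andP[? ?]; apply/andP; split; lra. Qed.

Lemma disj_sub I J K : sub_itv I J -> disj J K -> disj I K.
Proof. by move=> IJ d; apply/disjP => x /(sub_in IJ) /(disj_in d). Qed.

Lemma disj_sub2 I I' J J' : sub_itv I I' -> sub_itv J J' -> disj I' J' -> disj I J.
Proof.
move=> sI sJ d; apply: (disj_sub sI); rewrite disj_sym.
by apply: (disj_sub sJ); rewrite disj_sym.
Qed.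

(** The two halves that an x-caret, respectively a y-caret, cuts. *)
Definition xl I : itv := (I.1, I.2.+2).
Definition xr I : itv := (I.1 + t ^+ I.2.+2, I.2.+1).
Definition yl I : itv := (I.1, I.2.+1).
Definition yr I : itv := (I.1 + t ^+ I.2.+1, I.2.+2).

Lemma golden_sub I J : Ztau I.1 -> sub_itv I J -> golden J -> golden I.
Proof. by move=> Z /andP[? ?] [_ ? ?]; split=> //; lra. Qed.

Lemma sub_xl I : sub_itv (xl I) I.
Proof. by rewrite /sub_itv /= lexx /= lerD2l expt_le ?leqW ?leqnn. Qed.
Lemma sub_yl I : sub_itv (yl I) I.
Proof. by rewrite /sub_itv /= lexx /= lerD2l expt_le ?leqW ?leqnn. Qed.
Lemma sub_xr I : sub_itv (xr I) I.
Proof.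
rewrite /sub_itv /=; have := expt_split R I.2; have := expt_gt0 R I.2.+2.
by move=> ? ->; apply/andP; split; lra.
Qed.
Lemma sub_yr I : sub_itv (yr I) I.
Proof.
rewrite /sub_itv /=; have := expt_split R I.2; have := expt_gt0 R I.2.+1.
by move=> ? ->; apply/andP; split; lra.
Qed.

Lemma golden_xl I : golden I -> golden (xl I).
Proof. by move=> G; apply: (golden_sub _ (sub_xl I) G); case: G. Qed.
Lemma golden_yl I : golden I -> golden (yl I).
Proof. by move=> G; apply: (golden_sub _ (sub_yl I) G); case: G. Qed.
Lemma golden_xr I : golden I -> golden (xr I).
Proof.
move=> G; apply: (golden_sub _ (sub_xr I) G); case: G => Z _ _.
by apply: ZtauD => //; exact: Ztau_expt.
Qed.
Lemma golden_yr I : golden I -> golden (yr I).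
Proof.
move=> G; apply: (golden_sub _ (sub_yr I) G); case: G => Z _ _.
by apply: ZtauD => //; exact: Ztau_expt.
Qed.

Lemma disj_x I : disj (xl I) (xr I). Proof. by rewrite /disj /= lexx. Qed.
Lemma disj_y I : disj (yl I) (yr I). Proof. by rewrite /disj /= lexx. Qed.

Lemma in_itv_x I x : in_itv I x = in_itv (xl I) x || in_itv (xr I) x.
Proof.
rewrite /in_itv /= [in LHS](expt_split R I.2).
have h1 := expt_gt0 R I.2.+1; have h2 := expt_gt0 R I.2.+2.
apply/idP/idP => [|/orP[]] /andP[x1 x2]; [ | by apply/andP; split; lra | by apply/andP; split; lra].
have [x3|x3] := leP x (I.1 + t ^+ I.2.+2); first by rewrite x1.
by apply/orP; right; apply/andP; split; lra.
Qed.

Lemma in_itv_y I x : in_itv I x = in_itv (yl I) x || in_itv (yr I) x.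
Proof.
rewrite /in_itv /= [in LHS](expt_split R I.2).
have h1 := expt_gt0 R I.2.+1; have h2 := expt_gt0 R I.2.+2.
apply/idP/idP => [|/orP[]] /andP[x1 x2]; [ | by apply/andP; split; lra | by apply/andP; split; lra].
have [x3|x3] := leP x (I.1 + t ^+ I.2.+1); first by rewrite x1.
by apply/orP; right; apply/andP; split; lra.
Qed.

Lemma aff_xl I J x : aff (xl I) (xl J) x = aff I J x.
Proof. by rewrite /aff /= !exprS; field; rewrite expt_neq0 tau_neq0. Qed.
Lemma aff_xr I J x : aff (xr I) (xr J) x = aff I J x.
Proof. by rewrite /aff /= !exprS; field; rewrite expt_neq0 tau_neq0. Qed.

Lemma maps_xl f I J : maps f I J -> maps f (xl I) (xl J).
Proof. by move=> fIJ x /(sub_in (sub_xl I)) /fIJ ->; rewrite aff_xl. Qed.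
Lemma maps_xr f I J : maps f I J -> maps f (xr I) (xr J).
Proof. by move=> fIJ x /(sub_in (sub_xr I)) /fIJ ->; rewrite aff_xr. Qed.
Lemma maps_x f I J : maps f (xl I) (xl J) -> maps f (xr I) (xr J) -> maps f I J.
Proof.
move=> fl fr x; rewrite in_itv_x => /orP[] xI; first by rewrite fl // aff_xl.
by rewrite fr // aff_xr.
Qed.

Lemma maps_in f I J (x : I01) : maps f I J -> in_itv I (sval x) -> in_itv J (sval (f x)).
Proof. by move=> fIJ xI; rewrite fIJ //; exact: aff_in. Qed.

Lemma maps_comp f g I J K : maps f I J -> maps g J K -> maps (g * f)%g I K.
Proof.
move=> fIJ gJK x xI; rewrite -(aff_aff I J K) -fIJ //.
by apply: gJK; exact: maps_in fIJ xI.
Qed.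

Lemma maps_inv f I J : golden I -> maps f I J -> maps (f^-1)%g J I.
Proof.
move=> GI fIJ y yJ; have xI := aff_in I yJ.
pose x : I01 := point (in_golden GI xI).
have fx : f x = y by apply: val_inj; rewrite /= fIJ // aff_aff aff_id.
by rewrite -fx [(f^-1)%g _]bij_funK fx.
Qed.

Lemma mapsV_in f I J (x : I01) : golden I -> maps f I J -> in_itv J (sval (f x)) -> in_itv I (sval x).
Proof. by move=> GI fIJ /(maps_in (maps_inv GI fIJ)); rewrite [(f^-1)%g _]bij_funK. Qed.

Lemma golden_pt I : golden I -> exists x : I01, sval x = I.1 + t ^+ I.2.
Proof.
move=> [_ g0 g1]; have I0 := expt_gt0 R I.2.
have xI : 0 < I.1 + t ^+ I.2 <= 1 by apply/andP; split; lra.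
by exists (point xI).
Qed.

(** The images of the right end of [I] and of that of its left half determine
    the affine map. *)
Lemma maps_uniq f I J J' : golden I -> maps f I J -> maps f I J' -> J = J'.
Proof.
move=> GI fJ fJ'; have I0 := expt_gt0 R I.2.
have [x xE] := golden_pt GI; have [y yE] := golden_pt (golden_xl GI).
have xI : in_itv I (sval x) by rewrite /in_itv xE lexx ltrDl I0.
have yI : in_itv I (sval y).
  by apply: (sub_in (sub_xl I)); rewrite /in_itv yE lexx ltrDl expt_gt0.
have := fJ x xI; have := fJ y yI; rewrite fJ' // fJ' // /aff xE yE /=.
have T2 : 0 < t ^+ I.2.+2 by exact: expt_gt0.
have T1 : t ^+ I.2.+2 < t ^+ I.2 by exact: expt_lt.
rewrite !(addrC I.1) !addrK !mulfVK ?expt_neq0 // => e1 e2.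
have ne : t ^+ I.2.+2 / t ^+ I.2 != 1.
  by rewrite lt_eqF // ltr_pdivrMr // mul1r.
have e3 : (t ^+ J.2 - t ^+ J'.2) * (1 - t ^+ I.2.+2 / t ^+ I.2) = 0 by lra.
move/eqP: e3; rewrite mulf_eq0 !subr_eq0 [1 == _]eq_sym (negPf ne) orbF => /eqP e3.
have e4 : J.1 = J'.1 by lra.
by case: J J' e3 e4 {fJ fJ' e1 e2} => [a k] [b l] /= /expt_inj -> ->.
Qed.

Lemma maps_disj f I J I' J' : golden I -> golden J -> maps f I I' -> maps f J J' ->
  golden I' -> disj I J -> disj I' J'.
Proof.
move=> GI GJ fI fJ GI' d; apply/disjP => y yI'.
pose w : I01 := point (in_golden GI' yI').
have wE : f (bij_inv f w) = w by exact: bij_invK.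
have wI : in_itv I (sval (bij_inv f w)) by apply: (mapsV_in GI fI); rewrite wE.
apply/negP => yJ'; have := disj_in d wI.
by rewrite (mapsV_in GJ fJ) // wE.
Qed.

(** * Exchanges of two intervals *)

(** Both swaps of two disjoint intervals and rotations of one interval are of
    this form, for [A] and [B] with the same union as [C] and [D]. *)
Definition is_exchange A B C D f := [/\ maps f A C, maps f B D &
  forall x : I01, in_itv A (sval x) = false -> in_itv B (sval x) = false -> f x = x].

Definition exchange A B C D : bijection I01 := xget 1%g [set f | is_exchange A B C D f]%classic.

Lemma is_exchange_unique A B C D f g : is_exchange A B C D f -> is_exchange A B C D g -> f = g.
Proof.
move=> [fA fB f1] [gA gB g1]; apply: bijectionP => x; apply: val_inj => /=.
case xA: (in_itv A (sval x)); first by rewrite fA // gA.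
case xB: (in_itv B (sval x)); first by rewrite fB // gB.
by rewrite f1 ?g1.
Qed.

Lemma bijection_on (g h : R -> R) :
  (forall x, 0 < x <= 1 -> (0 < g x <= 1) && (h (g x) == x)) ->
  (forall x, 0 < x <= 1 -> (0 < h x <= 1) && (g (h x) == x)) ->
  exists f, forall x : I01, sval (f x) = g (sval x).
Proof.
move=> gP hP.
pose F (u : R -> R) (x : I01) : I01 := insubd x (u (sval x)).
have Fg x : sval (F g x) = g (sval x) by apply: insubdK; have /andP[] := gP _ (svalP x).
have Fh x : sval (F h x) = h (sval x) by apply: insubdK; have /andP[] := hP _ (svalP x).
have FK : cancel (F g) (F h).
  by move=> x; apply: val_inj; rewrite /= Fh Fg; apply/eqP; have /andP[] := gP _ (svalP x).
have FK' : cancel (F h) (F g).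
  by move=> x; apply: val_inj; rewrite /= Fg Fh; apply/eqP; have /andP[] := hP _ (svalP x).
by exists (Bijection FK FK').
Qed.

Lemma exchangeP A B C D : golden A -> golden B -> golden C -> golden D ->
  disj A B -> disj C D ->
  (forall x, in_itv A x || in_itv B x = in_itv C x || in_itv D x) ->
  is_exchange A B C D (exchange A B C D).
Proof.
move=> GA GB GC GD dAB dCD un.
have [f fP] : exists f, is_exchange A B C D f; last exact: (xgetPex 1%g (ex_intro _ f fP)).
pose ex A B C D x := if in_itv A x then aff A C x else if in_itv B x then aff B D x else x.
have exE A' B' C' D' x : golden C' -> golden D' -> disj A' B' -> disj C' D' ->
    (forall x, in_itv A' x || in_itv B' x = in_itv C' x || in_itv D' x) ->
    0 < x <= 1 -> (0 < ex A' B' C' D' x <= 1) && (ex C' D' A' B' (ex A' B' C' D' x) == x).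
  move=> GC' GD' dAB' dCD' un' x01; rewrite /ex.
  case xA: (in_itv A' x).
    have xC := aff_in C' xA; rewrite (in_golden GC' xC) xC.
    by rewrite aff_aff aff_id eqxx.
  case xB: (in_itv B' x).
    have xD := aff_in D' xB; rewrite (in_golden GD' xD) xD.
    by rewrite (disj_in _ xD) ?aff_aff ?aff_id ?eqxx // disj_sym.
  have := un' x; rewrite xA xB x01 /= => /esym/negbT; rewrite negb_or.
  by move=> /andP[/negbTE -> /negbTE ->] /=.
have [|x Hx|f fE] := @bijection_on (ex A B C D) (ex C D A B).
- by move=> x; apply: exE.
- by apply: exE => // y; rewrite un.
exists f; split=> [x xA|x xB|x xA xB].
- by rewrite fE /ex xA.
- by rewrite fE /ex xB (disj_in _ xB) // disj_sym.
- by apply: val_inj => /=; rewrite fE /ex xA xB.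
Qed.

Lemma is_exchange_Vtau A B C D f : golden A -> golden B -> golden C -> golden D ->
  is_exchange A B C D f -> Vtau f.
Proof.
move=> GA GB GC GD [fA fB f1]; apply: pieced_Vtau.
pose pc I J : (R * R) * (int * R) := ((I.1, I.1 + t ^+ I.2),
  (J.2%:Z - I.2%:Z, J.1 - t ^ (J.2%:Z - I.2%:Z) * I.1)).
pose id_pc (a b a' b' : R) : (R * R) * (int * R) := ((Num.max a a', Num.min b b'), (0, 0)).
have pcP I J : golden I -> golden J -> maps f I J -> golden_piece (pc I J) /\ affine_piece f (pc I J).
  move=> [ZI I0 I1] [ZJ J0 J1] fIJ; split.
    split=> //=; first by apply: ZtauD => //; exact: Ztau_expt.
    by apply: ZtauB => //; apply: ZtauM => //; exact: Ztau_exprz.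
  move=> x xI; rewrite [LHS]fIJ //= /aff expfzDr ?tau_neq0 // -exprnN -!exprnP.
  by ring.
have idP (a b a' b' : R) : Ztau a -> Ztau b -> Ztau a' -> Ztau b' -> 0 <= a -> b <= 1 ->
    (forall x : I01, a < sval x <= b -> a' < sval x <= b' -> f x = x) ->
    golden_piece (id_pc a b a' b') /\ affine_piece f (id_pc a b a' b').
  move=> Za Zb Za' Zb' a0 b1 fE; split.
    split=> /=; [exact: Ztau_max | exact: Ztau_min | exact: Ztau0 | by rewrite le_max a0 | by rewrite ge_min b1].
  move=> x /=; rewrite gt_max le_min => /andP[/andP[x1 x2] /andP[x3 x4]].
  by rewrite fE ?x1 ?x2 ?x3 ?x4 // expr0z mul1r addr0.
have [ZA A0 A1] := GA; have [ZB B0 B1] := GB.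
have ZA' : Ztau (A.1 + t ^+ A.2) by apply: ZtauD => //; exact: Ztau_expt.
have ZB' : Ztau (B.1 + t ^+ B.2) by apply: ZtauD => //; exact: Ztau_expt.
have Z0 := Ztau0 R; have Z1 := Ztau1 R.
have pA := expt_gt0 R A.2; have pB := expt_gt0 R B.2.
exists [:: pc A C; pc B D; id_pc 0 A.1 0 B.1; id_pc 0 A.1 (B.1 + t ^+ B.2) 1;
  id_pc (A.1 + t ^+ A.2) 1 0 B.1; id_pc (A.1 + t ^+ A.2) 1 (B.1 + t ^+ B.2) 1].
have out I (x : R) : x <= I.1 \/ I.1 + t ^+ I.2 < x -> in_itv I x = false.
  by move=> h; apply/negP => /andP[? ?]; have := expt_gt0 R I.2; case: h; lra.
split.
  move=> p; rewrite !inE => /or4P[/eqP->|/eqP->|/eqP->|]; [exact: pcP | exact: pcP | | ].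
    apply: idP => //; first lra.
    by move=> x /andP[x1 x2] /andP[x3 x4]; apply: f1; apply: out; left.
  move=> /or3P[]/eqP->; apply: idP => //; try lra;
    move=> x /andP[x1 x2] /andP[x3 x4]; apply: f1; apply: out; by [left | right].
move=> x; have /andP[x0 x1] := svalP x.
case xA: (in_itv A (sval x)); first by exists (pc A C); rewrite // inE eqxx.
case xB: (in_itv B (sval x)); first by exists (pc B D); rewrite // !inE eqxx orbT.
have alt I : in_itv I (sval x) = false -> (sval x <= I.1) || (I.1 + t ^+ I.2 < sval x).
  by rewrite /in_itv ltNge; case: (sval x <= I.1) => //= /negbT; rewrite -ltNge.
case/orP: (alt A xA) => hA; case/orP: (alt B xB) => hB.
- by exists (id_pc 0 A.1 0 B.1); rewrite ?inE ?eqxx ?orbT //= gt_max le_min x0 hA hB.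
- by exists (id_pc 0 A.1 (B.1 + t ^+ B.2) 1); rewrite ?inE ?eqxx ?orbT //= gt_max le_min x0 x1 hA hB.
- by exists (id_pc (A.1 + t ^+ A.2) 1 0 B.1); rewrite ?inE ?eqxx ?orbT //= gt_max le_min x0 x1 hA hB.
- by exists (id_pc (A.1 + t ^+ A.2) 1 (B.1 + t ^+ B.2) 1); rewrite ?inE ?eqxx ?orbT //= gt_max le_min x1 hA hB.
Qed.

Lemma is_exchange_conj A B C D A' B' C' D' f g :
  golden A -> golden B ->
  maps g A A' -> maps g B B' -> maps g C C' -> maps g D D' ->
  is_exchange A B C D f -> is_exchange A' B' C' D' (g * f * g^-1)%g.
Proof.
move=> GA GB gA gB gC gD [fA fB f1]; split.
- exact: maps_comp (maps_inv GA gA) (maps_comp fA gC).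
- exact: maps_comp (maps_inv GB gB) (maps_comp fB gD).
move=> x xA xB; have gx : g (bij_inv g x) = x by exact: bij_invK.
rewrite -[(g * f * g^-1)%g x]/(g (f (bij_inv g x))) f1 ?gx //.
  by apply/negP => h; move: xA; rewrite -gx (maps_in gA h).
by apply/negP => h; move: xB; rewrite -gx (maps_in gB h).
Qed.

End Intervals.

(** * Swaps *)

Section Swaps.
Variable R : realType.
Local Notation t := (tau R).
Local Notation I01 := (I01 R).
Local Notation itv := (itv R).
Implicit Types (I J K L A B C D : itv) (f g h : bijection I01).

Definition swap I J : bijection I01 := exchange I J J I.
(** The interval exchange of [K] that turns the subdivision by an x-caret into
    the subdivision by a y-caret. *)
Definition rotation K : bijection I01 := exchange (xl K) (xr K) (yr K) (yl K).

Lemma maps_fix f K : (forall x : I01, in_itv K (sval x) -> f x = x) -> maps f K K.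
Proof. by move=> fK x /fK ->; rewrite aff_id. Qed.

Lemma swapP I J : golden I -> golden J -> disj I J -> is_exchange I J J I (swap I J).
Proof.
by move=> GI GJ d; apply: exchangeP => //; [rewrite disj_sym | move=> x; exact: orbC].
Qed.

Lemma swap_Vtau I J : golden I -> golden J -> disj I J -> Vtau (swap I J).
Proof. by move=> GI GJ d; apply: is_exchange_Vtau (swapP GI GJ d). Qed.

Lemma swap_l I J : golden I -> golden J -> disj I J -> maps (swap I J) I J.
Proof. by move=> GI GJ /(swapP GI GJ)[]. Qed.
Lemma swap_r I J : golden I -> golden J -> disj I J -> maps (swap I J) J I.
Proof. by move=> GI GJ /(swapP GI GJ)[]. Qed.

Lemma swap_fix I J K : golden I -> golden J -> disj I J -> disj K I -> disj K J ->
  maps (swap I J) K K.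
Proof.
move=> GI GJ /(swapP GI GJ)[_ _ f1] dI dJ; apply: maps_fix => x xK.
by apply: f1; [exact: disj_in dI xK | exact: disj_in dJ xK].
Qed.

Lemma swap_eq I J f : golden I -> golden J -> disj I J -> is_exchange I J J I f -> f = swap I J.
Proof. by move=> GI GJ d fP; apply: is_exchange_unique fP (swapP GI GJ d). Qed.

Lemma swapK I J : golden I -> golden J -> disj I J -> (swap I J * swap I J = 1)%g.
Proof.
move=> GI GJ d; have [f1 f2 f3] := swapP GI GJ d.
apply: bijectionP => x; apply: val_inj => /=.
case xI: (in_itv I (sval x)).
  have h : maps (swap I J * swap I J)%g I I by apply: maps_comp f1 f2.
  by rewrite [LHS](h x xI) aff_id.
case xJ: (in_itv J (sval x)).
  have h : maps (swap I J * swap I J)%g J J by apply: maps_comp f2 f1.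
  by rewrite [LHS](h x xJ) aff_id.
by rewrite !f3.
Qed.

Lemma swapV I J : golden I -> golden J -> disj I J -> ((swap I J)^-1 = swap I J)%g.
Proof. by move=> GI GJ d; apply: (mulgI (swap I J)); rewrite mulgV swapK. Qed.

Lemma swap_conj I J I' J' g : golden I -> golden J -> golden I' -> golden J' ->
  disj I J -> maps g I I' -> maps g J J' -> (g * swap I J * g^-1 = swap I' J')%g.
Proof.
move=> GI GJ GI' GJ' d gI gJ; apply: swap_eq => //.
  exact: maps_disj GI GJ gI gJ GI' d.
by apply: is_exchange_conj (swapP GI GJ d).
Qed.

Lemma swap_split I J : golden I -> golden J -> disj I J ->
  swap I J = (swap (xl I) (xl J) * swap (xr I) (xr J))%g.
Proof.
move=> GI GJ d; symmetry; apply: swap_eq => //.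
have [GIl GIr GJl GJr] := And4 (golden_xl GI) (golden_xr GI) (golden_xl GJ) (golden_xr GJ).
have dx I' J' : sub_itv I' I -> sub_itv J' J -> disj I' J'.
  by move=> sI sJ; exact: disj_sub2 sI sJ d.
have dll := dx _ _ (sub_xl I) (sub_xl J); have dlr := dx _ _ (sub_xl I) (sub_xr J).
have drl := dx _ _ (sub_xr I) (sub_xl J); have drr := dx _ _ (sub_xr I) (sub_xr J).
have dI := disj_x I; have dJ := disj_x J.
have s := (disj_sym (R := R)).
split.
- apply: maps_x.
    by apply: maps_comp (swap_l GIl GJl dll); apply: swap_fix.
  by apply: maps_comp (swap_l GIr GJr drr) _; apply: swap_fix => //; rewrite s.
- apply: maps_x.
    by apply: maps_comp (swap_r GIl GJl dll); apply: swap_fix => //; rewrite s.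
  by apply: maps_comp (swap_r GIr GJr drr) _; apply: swap_fix => //; rewrite s.
move=> x; rewrite (in_itv_x I) (in_itv_x J) => /negbT; rewrite negb_or => /andP[/negbTE i1 /negbTE i2].
move=> /negbT; rewrite negb_or => /andP[/negbTE i3 /negbTE i4].
have [_ _ f1] := swapP GIl GJl dll; have [_ _ f2] := swapP GIr GJr drr.
by rewrite -[LHS]/(swap _ _ (swap _ _ x)) f2 // f1.
Qed.

(** * Rotations *)

Lemma rotP K : golden K -> is_exchange (xl K) (xr K) (yr K) (yl K) (rotation K).
Proof.
move=> G; apply: exchangeP; rewrite ?disj_x //; last 2 first.
- by rewrite disj_sym disj_y.
- by move=> x; rewrite -in_itv_x orbC -in_itv_y.
all: by [exact: golden_xl | exact: golden_xr | exact: golden_yl | exact: golden_yr].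
Qed.

Lemma rot_Vtau K : golden K -> Vtau (rotation K).
Proof.
move=> G; apply: is_exchange_Vtau (rotP G).
all: by [exact: golden_xl | exact: golden_xr | exact: golden_yl | exact: golden_yr].
Qed.

Lemma rot_fix K L : golden K -> disj L K -> maps (rotation K) L L.
Proof.
move=> /rotP[_ _ f1] d; apply: maps_fix => x xL.
have := disj_in d xL; rewrite in_itv_x => /negbT; rewrite negb_or => /andP[/negbTE ? /negbTE ?].
exact: f1.
Qed.

Lemma aff_yl I J x : aff (yl I) (yl J) x = aff I J x.
Proof. by rewrite /aff /= !exprS; field; rewrite expt_neq0 tau_neq0. Qed.
Lemma aff_yr I J x : aff (yr I) (yr J) x = aff I J x.
Proof. by rewrite /aff /= !exprS; field; rewrite expt_neq0 tau_neq0. Qed.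

Lemma rot_conj K K' g : golden K -> golden K' -> maps g K K' -> (g * rotation K * g^-1 = rotation K')%g.
Proof.
move=> GK GK' gK; apply: is_exchange_unique (rotP GK').
have gl : maps g (yl K) (yl K') by move=> x /(sub_in (sub_yl K)) /gK ->; rewrite aff_yl.
have gr : maps g (yr K) (yr K') by move=> x /(sub_in (sub_yr K)) /gK ->; rewrite aff_yr.
apply: is_exchange_conj (rotP GK) => //.
- exact: golden_xl.
- exact: golden_xr.
- exact: maps_xl.
- exact: maps_xr.
Qed.

(** Cutting by an x-caret and then the right half by an x-caret, or cutting by
    a y-caret and then the left half by a y-caret, gives the same three
    intervals. *)
Lemma xr_xr K : xr (xr K) = yr K.
Proof. by rewrite /xr /yr /= -addrA -expt_split. Qed.

(** With the three intervals of [xr_xr], [rotation K] carries the first to the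
    last and shifts the other two to the left; [rotation (yl K)] then puts the
    middle one back. *)
Lemma rot_rot K : golden K -> (rotation (yl K) * rotation K = swap (xl K) (yr K))%g.
Proof.
move=> G; have Gl := golden_yl G; have [f1 f2 f3] := rotP G; have [g1 g2 g3] := rotP Gl.
have [Gxl Gyr] := conj (golden_xl G) (golden_yr G).
have dlr : disj (yr K) (yl K) by rewrite disj_sym disj_y.
have d : disj (xl K) (yr K).
  by apply: disj_sub (disj_y K); rewrite /sub_itv /= lexx lerD2l expt_le.
apply: swap_eq => //; split.
- by apply: maps_comp f1 _; apply: rot_fix.
- by rewrite -xr_xr; apply: maps_comp (maps_xr f2) g2.
have mB : maps (rotation (yl K) * rotation K)%g (xl (xr K)) (xl (xr K)).
  exact: maps_comp (maps_xl f2) g1.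
move=> x x1 x2; case x3: (in_itv (xl (xr K)) (sval x)).
  by apply: val_inj => /=; rewrite [LHS](mB x x3) aff_id.
have x4 : in_itv (xr K) (sval x) = false by rewrite in_itv_x x3 xr_xr x2.
have x5 : in_itv (yl K) (sval x) = false.
  have : in_itv K (sval x) = false by rewrite in_itv_x x1 x4.
  by rewrite in_itv_y => /negbT; rewrite negb_or => /andP[/negbTE].
rewrite -[LHS]/(rotation _ (rotation _ x)) f3 // g3 //.
  by move: x5; rewrite in_itv_x => /negbT; rewrite negb_or => /andP[/negbTE].
by move: x5; rewrite in_itv_x => /negbT; rewrite negb_or => /andP[_ /negbTE].
Qed.

(** * Small golden intervals *)

Lemma golden_dense (u v : R) : 0 <= u -> u < v -> v <= 1 ->
  exists A, [/\ golden A, u <= A.1 & A.1 + t ^+ A.2 <= v].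
Proof.
move=> u0 uv v1; have [k kP] : exists k, t ^+ k < (v - u) / 2.
  by apply: expt_small; rewrite divr_gt0 // subr_gt0.
have tk := expt_gt0 R k.
have /andP[m1 m2] := truncn_itv (divr_ge0 u0 (ltW tk)).
set m := Num.truncn _ in m1 m2.
move: m1 m2; rewrite ler_pdivlMr // ltr_pdivrMr // -natr1 mulrDl mul1r => m1 m2.
exists ((m%:R + 1) * t ^+ k, k); rewrite /golden /= mulrDl mul1r.
have Z : Ztau (m%:R * t ^+ k + t ^+ k).
  apply: ZtauD (Ztau_expt _ _); apply: ZtauM (Ztau_expt _ _).
  by apply/ZtauP; exists m%:Z, 0; rewrite mul0r addr0.
by split; [split=> // | |]; lra.
Qed.

Lemma golden_meet A C : golden A -> golden C -> ~~ disj A C ->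
  exists D, [/\ golden D, sub_itv D A & sub_itv D C].
Proof.
move=> [_ A0 A1] [_ C0 C1]; rewrite /disj negb_or -!ltNge => /andP[h1 h2].
have pA := expt_gt0 R A.2; have pC := expt_gt0 R C.2.
have [D [GD D1 D2]] : exists D, [/\ golden D, Num.max A.1 C.1 <= D.1 &
    D.1 + t ^+ D.2 <= Num.min (A.1 + t ^+ A.2) (C.1 + t ^+ C.2)].
  apply: golden_dense; first by rewrite le_max A0.
    by rewrite gt_max !lt_min h1 h2 !ltrDl pA pC.
  by rewrite ge_min A1.
exists D; move: D1 D2; rewrite ge_max le_min => /andP[d1 d2] /andP[d3 d4].
by split=> //; rewrite /sub_itv ?d1 ?d2 ?d3 ?d4.
Qed.

(** The exponent of the length of the image is nonnegative since the image stays
    inside (0, 1]. *)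
Lemma maps_on_piece f p A : golden_piece p -> affine_piece f p -> golden A ->
  p.1.1 <= A.1 -> A.1 + t ^+ A.2 <= p.1.2 -> exists2 B, golden B & maps f A B.
Proof.
case: p => [[a b] [k c]] [/= _ _ Zc a0 b1] fP [ZA A0 A1] aA Ab.
have pA := expt_gt0 R A.2.
have fA : affine_piece f ((A.1, A.1 + t ^+ A.2), (k, c)).
  by move=> x /= /andP[x1 x2]; apply: fP => /=; apply/andP; split; lra.
have lo : 0 <= t ^ k * A.1 + c by apply: affine_image_ge0 fA; lra.
have hi : t ^ k * (A.1 + t ^+ A.2) + c <= 1.
  have xI : 0 < A.1 + t ^+ A.2 <= 1 by apply/andP; split; lra.
  have /andP[_] := svalP (f (point xI)).
  by rewrite [sval (f _)]fA //= lexx andbT ltrDl.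
have lenE : t ^ k * t ^+ A.2 = t ^ (k + A.2%:Z) by rewrite expfzDr ?tau_neq0.
have len1 : t ^ (k + A.2%:Z) <= 1 by rewrite -lenE; move: hi; rewrite mulrDr; lra.
have [n nE] : exists n : nat, k + A.2%:Z = n%:Z.
  case: (k + A.2%:Z) len1 => n; first by exists n.
  rewrite NegzE -exprnN invf_le1 ?expt_gt0 // => h.
  by have := lt_le_trans (expt_lt R (ltn0Sn n)) h; rewrite ltxx.
exists (t ^ k * A.1 + c, n).
  split=> //=; first by apply: ZtauD => //; apply: ZtauM => //; exact: Ztau_exprz.
  by move: hi; rewrite mulrDr lenE nE -exprnP; lra.
move=> x xA; rewrite [LHS]fA // /aff /= exprnP -nE -lenE.
by field; rewrite expt_neq0.
Qed.

(** A short interval ending at a displaced point [x] works: by left continuity its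
    image stays close to [f x]. *)
Lemma displaced_itv f : Vtau f -> f <> 1%g ->
  exists A B, [/\ golden A, golden B, disj A B & maps f A B].
Proof.
move=> Vf f1; have [x fx] : exists x, sval (f x) != sval x.
  apply: contrapT => h; apply: f1; apply: bijectionP => x; apply: val_inj => /=.
  by apply/eqP/negPn/negP => ne; apply: h; exists x.
have [lc _] := Vf; have [s [sP sC]] := Vtau_pieced Vf.
have [p ps /andP[px1 px2]] := sC x; have [Gp fp] := sP p ps.
set e := `|sval (f x) - sval x| / 2.
have e0 : 0 < e by rewrite divr_gt0 // normr_gt0 subr_eq0.
have [d d0 dP] := lc x e e0.
have [P1 P2 P3 P4 P5] := Gp.
have x0 := svalP x; have [x00 x01] := andP x0.
pose u := Num.max p.1.1 (sval x - Num.min d e).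
have [A [GA uA Ax]] : exists A, [/\ golden A, u <= A.1 & A.1 + t ^+ A.2 <= sval x].
  apply: golden_dense => //; first by rewrite le_max P4.
  by rewrite /u gt_max px1 /= ltrBlDr ltrDl lt_min d0.
have [Ap Ad] : p.1.1 <= A.1 /\ sval x - Num.min d e <= A.1 by apply/andP; rewrite -ge_max.
have [m1 m2] : Num.min d e <= d /\ Num.min d e <= e by rewrite !ge_min !lexx orbT.
have [B GB fAB] := maps_on_piece Gp fp GA Ap (le_trans Ax px2).
exists A, B; split=> //; apply/disjP => y yA; apply/negP => yB.
pose w := point (in_golden GB yB).
have wE : f (bij_inv f w) = w by exact: bij_invK.
have /andP[z1 z2] : in_itv A (sval (bij_inv f w)) by apply: (mapsV_in GA fAB); rewrite wE.
have near : `|y - sval (f x)| < e.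
  rewrite -[y]/(sval w) -wE; apply: dP.
  suff: sval x - d < sval (bij_inv f w) <= sval x by [].
  by apply/andP; split; lra.
case/andP: yA => y1 y2.
have : `|sval (f x) - sval x| < e + e.
  have -> : sval (f x) - sval x = (y - sval x) - (y - sval (f x)) by ring.
  apply: le_lt_trans (ler_normB _ _) _; apply: ler_ltD => //.
  by rewrite ler_norml; apply/andP; split; lra.
by rewrite /e -splitr ltxx.
Qed.

End Swaps.

(** * Congruence modulo a normalized subgroup *)

Lemma subgroupP (G : groupType) (H : set G) :
  subgroup H <-> H 1%g /\ forall x y, H x -> H y -> H (x * y^-1)%g.
Proof.
split=> [[H1 HD]|[H1 HD]].
  split; first by move: H1; rewrite in_setE.
  by move=> x y Hx Hy; have := HD x y; rewrite !in_setE; apply.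
split; first by rewrite in_setE.
by move=> x y; rewrite !in_setE => Hx Hy; exact: HD.
Qed.

Lemma subgroup_inv (G : groupType) (H : set G) x : subgroup H -> H x -> H (x^-1)%g.
Proof. by move=> /subgroupP[H1 HD] Hx; rewrite -[(x^-1)%g]mul1g; apply: HD. Qed.

Lemma subgroup_mul (G : groupType) (H : set G) x y : subgroup H -> H x -> H y -> H (x * y)%g.
Proof.
move=> HH Hx Hy; have /subgroupP[H1 HD] := HH.
by rewrite -[y]invgK; apply: HD (subgroup_inv HH Hy).
Qed.

Section Congruence.
Variables (G : groupType) (N S : set G).
Implicit Types f g h : G.

(** To be used both for a normal subgroup of the kernel, with [S] the kernel, and
    for a subgroup of the kernel that is invariant under [S = Vtau]. *)
Definition normalized := subgroup N /\ forall f g, N f -> S g -> N (g * f * g^-1)%g.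
Hypothesis NP : normalized.

Lemma normalized1 : N 1%g. Proof. by have [/subgroupP[]] := NP. Qed.
Lemma normalizedV f : N f -> N (f^-1)%g. Proof. by have [h _] := NP; apply: subgroup_inv. Qed.
Lemma normalizedM f g : N f -> N g -> N (f * g)%g.
Proof. by have [h _] := NP; apply: subgroup_mul. Qed.
Lemma normalizedJ f g : N f -> S g -> N (g * f * g^-1)%g. Proof. by have [_] := NP; apply. Qed.

Definition cong f g := N (f * g^-1)%g.

Lemma cong_refl f : cong f f. Proof. by rewrite /cong mulgV; exact: normalized1. Qed.
Lemma cong_sym f g : cong f g -> cong g f.
Proof. by move=> /normalizedV; rewrite invgM invgK. Qed.
Lemma cong_trans f g h : cong f g -> cong g h -> cong f h.
Proof. by move=> fg gh; have := normalizedM fg gh; rewrite mulgA mulgKV. Qed.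
Lemma congM f f' g g' : S f -> cong f f' -> cong g g' -> cong (f * g)%g (f' * g')%g.
Proof.
move=> Sf ff gg; rewrite /cong invgM mulgA.
by have := normalizedM (normalizedJ gg Sf) ff; rewrite !mulgA mulgKV.
Qed.
Lemma cong_conj f g h : S h -> cong f g -> cong (h * f * h^-1)%g (h * g * h^-1)%g.
Proof.
by move=> Sh fg; rewrite /cong; have := normalizedJ fg Sh; rewrite !invgM invgK !mulgA mulgKV.
Qed.
Lemma cong_mem f g : cong f g -> N g -> N f.
Proof. by move=> fg Ng; have := normalizedM fg Ng; rewrite mulgKV. Qed.

End Congruence.

(** * Normal subgroups of the kernel contain all swaps *)

Section Kernel.
Variables (R : realType) (phi : bijection (I01 R) -> 'Z_2).
Hypothesis phiP : is_varphi phi.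
Local Notation t := (tau R).
Local Notation I01 := (I01 R).
Local Notation itv := (itv R).
Implicit Types (I J K L A B C D X Y Z : itv) (f g h : bijection I01).
Local Notation Vxz := (Vxz phi).

Lemma phiM f g : Vtau f -> Vtau g -> phi (f * g)%g = phi f + phi g.
Proof. by case: phiP => h _ _ _ _; apply: h. Qed.

Lemma phi1 : phi 1%g = 0.
Proof.
have V1 := Vtau1 R; have := phiM V1 V1; rewrite mulg1 => /eqP.
by rewrite -[X in X == _]addr0 (inj_eq (addrI _)) eq_sym => /eqP.
Qed.

Lemma phiV f : Vtau f -> phi (f^-1)%g = - phi f.
Proof.
move=> Vf; have := phiM Vf (VtauV Vf); rewrite mulgV phi1 => /esym/eqP.
by rewrite addrC addr_eq0 => /eqP.
Qed.

Lemma phi_conj f g : Vtau f -> Vtau g -> phi (g * f * g^-1)%g = phi f.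
Proof.
move=> Vf Vg; have Vg' := VtauV Vg; have Vgf := VtauM Vg Vf.
by rewrite phiM // phiM // phiV // addrC addrA addNr add0r.
Qed.

Lemma Vxz_subgroup : subgroup Vxz.
Proof.
apply/subgroupP; split; first by split; [exact: Vtau1 | exact: phi1].
move=> f g [Vf f0] [Vg g0]; have Vg' := VtauV Vg; split; first exact: VtauM.
by rewrite phiM // phiV // f0 g0 subr0.
Qed.

(** A swap is the product of two swaps of halves, which are conjugate in Vtau. *)
Lemma phi_swap I J : golden I -> golden J -> disj I J -> phi (swap I J) = 0.
Proof.
move=> GI GJ d; rewrite swap_split //.
have [GIl GIr GJl GJr] := And4 (golden_xl GI) (golden_xr GI) (golden_xl GJ) (golden_xr GJ).
have dx I' J' : sub_itv I' I -> sub_itv J' J -> disj I' J'.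
  by move=> sI sJ; exact: disj_sub2 sI sJ d.
have dll := dx _ _ (sub_xl I) (sub_xl J); have dlr := dx _ _ (sub_xl I) (sub_xr J).
have drl := dx _ _ (sub_xr I) (sub_xl J); have drr := dx _ _ (sub_xr I) (sub_xr J).
have dI := disj_x I; have dJ := disj_x J.
pose g := (swap (xl I) (xr I) * swap (xl J) (xr J))%g.
have Vg : Vtau g by apply: VtauM; apply: swap_Vtau.
have gI : maps g (xl I) (xr I).
  by apply: maps_comp (swap_l GIl GIr dI); apply: swap_fix.
have gJ : maps g (xl J) (xr J).
  by apply: maps_comp (swap_l GJl GJr dJ) _; apply: swap_fix; rewrite // disj_sym.
rewrite phiM; try exact: swap_Vtau.
rewrite -(swap_conj GIl GJl GIr GJr dll gI gJ) phi_conj //; last exact: swap_Vtau.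
by case: (phi _) => [[|[|//]] ?]; apply: val_inj.
Qed.

Lemma swap_Vxz I J : golden I -> golden J -> disj I J -> Vxz (swap I J).
Proof. by move=> GI GJ d; split; [exact: swap_Vtau | exact: phi_swap]. Qed.

Lemma normal_normalized (N : set (bijection I01)) : normal_subgroup N Vxz -> normalized N Vxz.
Proof.
move=> [NS _ NJ]; split=> // f g Nf Kg.
by have := NJ _ _ Nf (subgroup_inv Vxz_subgroup Kg); rewrite conjgE invgK mulgA.
Qed.

Section NormalSubgroup.
Variable N : set (bijection I01).
Hypothesis NP : normalized N Vxz.
Local Notation cong := (cong N).

Variable e : bijection I01.
Hypothesis e2 : (e * e = 1)%g.

Definition uniform_off D := forall I J, golden I -> golden J -> disj I J ->
  disj I D -> disj J D -> cong (swap I J) e.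

(** For [I] away from [D], the swap of [Z] and [I] conjugates the swap of [X]
    and [Z] to that of [X] and [I], and fixes the swap of [X] and [Y]; so the
    swap of [X] and [I] has class [e] as well. For [I] and [J] away from [D],
    the swap of [I] and [J] is the conjugate of that of [X] and [J] by that of
    [X] and [I], of class [e * e * e = e]. *)
Lemma uniform_off_from X Y Z D : golden X -> golden Y -> golden Z ->
  disj X Y -> disj X Z -> disj Y Z -> sub_itv X D -> sub_itv Y D -> sub_itv Z D ->
  cong (swap X Y) e -> cong (swap X Z) e -> uniform_off D.
Proof.
move=> GX GY GZ dXY dXZ dYZ sX sY sZ cY cZ.
have s := (disj_sym (R := R)).
have XI I : golden I -> disj I D -> cong (swap X I) e.
  move=> GI dI; have dIX : disj I X by rewrite s; apply: disj_sub sX _; rewrite s.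
  have dIY : disj I Y by rewrite s; apply: disj_sub sY _; rewrite s.
  have dIZ : disj I Z by rewrite s; apply: disj_sub sZ _; rewrite s.
  have dZI : disj Z I by rewrite s.
  have Kg := swap_Vxz GZ GI dZI.
  have := cong_conj NP Kg (cong_trans NP cZ (cong_sym NP cY)).
  rewrite (swap_conj (I' := X) (J' := I)) ?(swap_conj (I' := X) (J' := Y)) //;
    try exact: swap_l; try (by apply: swap_fix; rewrite // s).
  by move=> h; exact: (cong_trans NP h cY).
move=> I J GI GJ dIJ dI dJ.
have dXI : disj X I by apply: disj_sub sX _; rewrite s.
have dXJ : disj X J by apply: disj_sub sX _; rewrite s.
have cI := XI I GI dI; have cJ := XI J GJ dJ.
have Kg := swap_Vxz GX GI dXI.
have -> : swap I J = (swap X I * swap X J * (swap X I)^-1)%g.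
  symmetry; apply: swap_conj => //; first exact: swap_l.
  by apply: swap_fix; rewrite // s.
rewrite swapV // -[e]mul1g -e2; apply: (congM NP) => //; last first.
  exact: (congM NP).
have /subgroupP[_ KD] := Vxz_subgroup; have KJ := swap_Vxz GX GJ dXJ.
by have := KD _ _ Kg KJ; rewrite swapV.
Qed.

Lemma uniform_off_disj A B : golden B -> disj B A -> uniform_off A -> uniform_off B.
Proof.
move=> GB dBA uA.
have Gl := golden_xl GB; have Gr := golden_xr GB.
have Grl := golden_xl Gr; have Grr := golden_xr Gr.
have sl := sub_xl B; have sr := sub_xr B.
have srl := sub_trans (sub_xl (xr B)) sr; have srr := sub_trans (sub_xr (xr B)) sr.
have d1 : disj (xl B) (xl (xr B)) by apply: disj_sub2 (disj_x B); [exact: sub_refl | exact: sub_xl].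
have d2 : disj (xl B) (xr (xr B)) by apply: disj_sub2 (disj_x B); [exact: sub_refl | exact: sub_xr].
have dA I : sub_itv I B -> disj I A by move=> sI; apply: disj_sub sI dBA.
by apply: (uniform_off_from Gl Grl Grr d1 d2 (disj_x _) sl srl srr); apply: uA => //; apply: dA.
Qed.

End NormalSubgroup.

(** Let [n] in [N] carry [A] to a disjoint [B]. For [g], [h] supported in [A],
    [g] times the conjugate of [g^-1] by [n] is in [N], and comparing it with
    its conjugate by [h] shows that [h g h^-1] and [g] are congruent. Swaps of
    parts of [A] with a common part are thus congruent to the same [e]; moving
    them around, so are all swaps that leave some room, such as the two halves
    of an arbitrary swap. So an arbitrary swap is congruent to [e^2 = 1]. *)
Lemma normal_contains_swaps (N : set (bijection I01)) : normal_subgroup N Vxz ->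
  N <> [set 1%g]%classic -> forall I J, golden I -> golden J -> disj I J -> N (swap I J).
Proof.
move=> NN Nnt; have NP := normal_normalized NN.
have [n Nn n1] : exists2 n, N n & n <> 1%g.
  apply: contrapT => h; apply: Nnt; apply/seteqP; split=> [x Nx|x ->]; last exact: normalized1 NP.
  by apply: contrapT => x1; apply: h; exists x.
have [_ NK _] := NN; have [Vn _] := NK n Nn.
have s := (disj_sym (R := R)).
have [A [B [GA GB dAB nAB]]] := displaced_itv Vn n1.
have Gl := golden_xl GA; have Gr := golden_xr GA.
have Grl := golden_xl Gr; have Grr := golden_xr Gr.
have sl := sub_xl A; have sr := sub_xr A.
have srl := sub_trans (sub_xl (xr A)) sr; have srr := sub_trans (sub_xr (xr A)) sr.
have d1 : disj (xl A) (xl (xr A)) by apply: disj_sub2 (disj_x A); [exact: sub_refl | exact: sub_xl].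
have d2 : disj (xl A) (xr (xr A)) by apply: disj_sub2 (disj_x A); [exact: sub_refl | exact: sub_xr].
have d3 := disj_x (xr A).
have Hl := golden_xl GB; have Hrl := golden_xl (golden_xr GB).
have tl := sub_xl B; have trl := sub_trans (sub_xl (xr B)) (sub_xr B).
have d4 : disj (xl B) (xl (xr B)) by apply: disj_sub2 (disj_x B); [exact: sub_refl | exact: sub_xl].
have dBA I J : sub_itv I B -> sub_itv J A -> disj I J.
  by move=> sI sJ; apply: disj_sub2 sI sJ _; rewrite s.
pose e := swap (xl A) (xl (xr A)); pose e' := swap (xl B) (xl (xr B)).
have Ke : Vxz e by apply: swap_Vxz.
have nE : (n * e * n^-1)%g = e'.
  by apply: swap_conj => //; [exact: maps_xl | exact/maps_xl/maps_xr].
have Nu : N (e * e')%g.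
  rewrite -nE -{1}[e]invgK -[(e^-1)^-1%g]invgK swapV // -/e.
  have := normalizedM NP (normalizedJ NP Nn Ke) (normalizedV NP Nn).
  by rewrite {2}/e swapV // -/e !mulgA.
pose h := swap (xl (xr A)) (xr (xr A)).
have Kh : Vxz h by apply: swap_Vxz.
have hE : (h * e * h^-1)%g = swap (xl A) (xr (xr A)).
  by apply: swap_conj => //; [exact: swap_fix | exact: swap_l].
have hE' : (h * e' * h^-1)%g = e'.
  by apply: swap_conj => //; apply: swap_fix => //; exact: dBA.
have c0 : cong N (swap (xl A) (xr (xr A))) e.
  have := normalizedM NP (normalizedJ NP Nu Kh) (normalizedV NP Nu).
  have -> : (h * (e * e') * h^-1 = (h * e * h^-1) * (h * e' * h^-1))%g by rewrite !mulgA mulgKV.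
  by rewrite hE hE' invgM mulgA mulgK.
have e2 : (e * e = 1)%g by apply: swapK.
have uA : uniform_off N e A.
  exact: (uniform_off_from NP e2 Gl Grl Grr d1 d2 d3 sl srl srr (cong_refl NP e) c0).
have uB : uniform_off N e B by apply: uniform_off_disj uA => //; rewrite s.
have key C I J : golden C -> golden I -> golden J -> disj I J -> disj I C -> disj J C ->
    cong N (swap I J) e.
  move=> GC GI GJ dIJ dIC dJC.
  have [D [sDC uD]] : exists D, sub_itv D C /\ uniform_off N e D.
    have [dAC|] := boolP (disj A C).
      by exists C; split; [exact: sub_refl | apply: uniform_off_disj uA => //; rewrite s].
    move=> /(golden_meet GA GC)[D [GD DA DC]]; exists D; split=> //.
    by apply: uniform_off_disj uB => //; apply: disj_sub DA _.
  by apply: uD => //; rewrite s; apply: disj_sub sDC _; rewrite s.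
move=> I J GI GJ d; rewrite swap_split //.
have [GIl GIr GJl GJr] := And4 (golden_xl GI) (golden_xr GI) (golden_xl GJ) (golden_xr GJ).
have dx I' J' : sub_itv I' I -> sub_itv J' J -> disj I' J'.
  by move=> sI sJ; exact: disj_sub2 sI sJ d.
have dll := dx _ _ (sub_xl I) (sub_xl J); have dlr := dx _ _ (sub_xl I) (sub_xr J).
have drl := dx _ _ (sub_xr I) (sub_xl J); have drr := dx _ _ (sub_xr I) (sub_xr J).
have dI := disj_x I; have dJ := disj_x J.
have c1 : cong N (swap (xl I) (xl J)) e.
  by apply: key GIr _ _ _ _ _; rewrite // s.
have c2 : cong N (swap (xr I) (xr J)) e.
  by apply: key GIl _ _ _ _ _; rewrite // s.
have := congM NP (swap_Vxz GIl GJl dll) c1 c2.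
by rewrite /cong e2 invg1 mulg1.
Qed.

(** * The monolith *)

(** The intersection of all nontrivial normal subgroups of the kernel. Unlike any
    single one of them, it is visibly invariant under the whole of Vtau, which
    contains rotations outside the kernel. *)
Definition monolith : set (bijection I01) := [set f | forall N, normal_subgroup N Vxz ->
  N <> [set 1%g]%classic -> N f]%classic.

Lemma monolith_swap I J : golden I -> golden J -> disj I J -> monolith (swap I J).
Proof. by move=> GI GJ d N NP N1; apply: normal_contains_swaps. Qed.

Lemma VxzJ f g : Vxz f -> Vtau g -> Vxz (g * f * g^-1)%g.
Proof.
move=> [Vf f0] Vg; split; last by rewrite phi_conj.
by apply: VtauM (VtauV Vg); apply: VtauM.
Qed.

(** Conjugation by an element of Vtau permutes the nontrivial normal subgroups of
    the kernel. *)
Lemma monolith_normalized : normalized monolith (@Vtau R).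
Proof.
split.
  apply/subgroupP; split=> [|f g Mf Mg] N NN nt; have NP := normal_normalized NN.
    exact: normalized1 NP.
  exact: (normalizedM NP (Mf N NN nt) (normalizedV NP (Mg N NN nt))).
move=> f g Mf Vg N NN nt; have NP := normal_normalized NN.
pose N' : set (bijection I01) := [set x | N (g * x * g^-1)%g]%classic.
suff : N' f by [].
have Vg' := VtauV Vg.
apply: Mf.
  split.
  - apply/subgroupP; split; first by rewrite /N' /= mulg1 mulgV; exact: normalized1 NP.
    move=> x y Nx Ny; have := normalizedM NP Nx (normalizedV NP Ny).
    by rewrite /N' /= !invgM invgK !mulgA mulgKV.
  - move=> x Nx; have [_ NK _] := NN; have := VxzJ (NK _ Nx) Vg'.
    by rewrite invgK !mulgA mulVg mul1g mulgKV.
  - move=> x y Nx Ky; rewrite /N' /=.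
    have Ky' := subgroup_inv Vxz_subgroup Ky.
    have := normalizedJ NP Nx (VxzJ Ky' Vg).
    by rewrite conjgE !invgM !invgK !mulgA !mulgKV.
move=> N'1; apply: nt; apply/seteqP; split=> [x Nx|x ->]; last exact: normalized1 NP.
have : N' (g^-1 * x * g)%g by rewrite /N' /= !mulgA mulgV mul1g mulgK.
rewrite N'1 => /= h; have : (g * (g^-1 * x * g) * g^-1 = 1)%g by rewrite h mulg1 mulgV.
by rewrite !mulgA mulgV mul1g mulgK.
Qed.

Lemma Vxz_nontrivial : Vxz <> [set 1%g]%classic.
Proof.
pose I : itv := (0, 0%N).
have GI : golden I by split; [exact: Ztau0 | rewrite /= | rewrite /= add0r expr0].
have [Gl Gr d] := And3 (golden_xl GI) (golden_xr GI) (disj_x I).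
move=> e; have : Vxz (swap (xl I) (xr I)) by apply: swap_Vxz.
rewrite e => /= s1; have [x xE] := golden_pt Gl.
have xI : in_itv (xl I) (sval x) by rewrite /in_itv xE lexx ltrDl expt_gt0.
have := maps_in (swap_l Gl Gr d) xI.
by rewrite s1 [(1%g : bijection I01) x]/= (disj_in d xI).
Qed.

Lemma monolith_Vxz f : monolith f -> Vxz f.
Proof.
apply; last exact: Vxz_nontrivial.
split=> //; first exact: Vxz_subgroup.
move=> x y Kx Ky; rewrite conjgE; have K := Vxz_subgroup.
by apply: (subgroup_mul K); [exact: subgroup_inv K _ | exact: subgroup_mul K _ _].
Qed.

(** * Rotations modulo the monolith *)

Local Notation M := monolith.
Local Notation MP := monolith_normalized.

Lemma rot_cong_disj K L : golden K -> golden L -> disj K L -> cong M (rotation L) (rotation K).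
Proof.
move=> GK GL d; have Ms := monolith_swap GK GL d.
rewrite -(rot_conj GK GL (swap_l GK GL d)) /cong.
have := normalizedM MP Ms (normalizedJ MP (normalizedV MP Ms) (rot_Vtau GK)).
by rewrite !mulgA.
Qed.

(** The product of the rotations of [yl L] and of [L] is a swap, for [L = K] and
    for [L = yl K]. The rotations of [yl K] and of [yl (yl K)] are congruent, as
    [yr K] is disjoint from both intervals. Hence the rotation of [yl K] has a
    trivial square, and the one of [K], congruent to its inverse, does too. *)
Lemma rot_yl K : golden K -> M (rotation K * rotation K)%g /\ cong M (rotation (yl K)) (rotation K).
Proof.
move=> GK; have [Gl Gr] := conj (golden_yl GK) (golden_yr GK); have Gll := golden_yl Gl.
have Vl := rot_Vtau Gl.
have M1 L : golden L -> M (rotation (yl L) * rotation L)%g.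
  move=> GL; rewrite rot_rot //; apply: monolith_swap; [exact: golden_xl | exact: golden_yr |].
  by apply: disj_sub (disj_y L); rewrite /sub_itv /= lexx lerD2l expt_le.
have d := disj_y K.
have c1 := rot_cong_disj Gl Gr d.
have c2 := rot_cong_disj Gll Gr (disj_sub (sub_yl _) d).
have c3 : cong M (rotation (yl K)) (rotation (yl (yl K))) := cong_trans MP (cong_sym MP c1) c2.
have h1 : M (rotation (yl K) * rotation (yl K))%g.
  by have := normalizedM MP c3 (M1 _ Gl); rewrite mulgA mulgKV.
have c4 : cong M (rotation K) (rotation (yl K)).
  have := normalizedJ MP (normalizedM MP (normalizedV MP h1) (M1 _ GK)) Vl.
  by rewrite invgM !mulgA mulgV mul1g mulVg mul1g.
split; last exact: (cong_sym MP c4).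
by have := normalizedM MP c4 (M1 _ GK); rewrite mulgA mulgKV.
Qed.

Lemma rot_shrink K j : golden K ->
  golden (K.1, (K.2 + j)%N) /\ cong M (rotation (K.1, (K.2 + j)%N)) (rotation K).
Proof.
move=> GK; elim: j => [|j [GJ IH]]; first by rewrite addn0; case: K GK => a k GK; split=> //; exact: cong_refl MP _.
rewrite addnS; have Gy := golden_yl GJ; split=> //.
by have [_ c] := rot_yl GJ; exact: (cong_trans MP c IH).
Qed.

(** Shrunk towards their left ends, which does not change the classes of their
    rotations, two intervals become equal or disjoint. *)
Lemma rot_cong K L : golden K -> golden L -> cong M (rotation K) (rotation L).
Proof.
wlog KL : K L / K.1 <= L.1.
  move=> W GK GL; have [KL|LK] := leP K.1 L.1; first exact: W.
  by apply: (cong_sym MP); apply: W => //; exact: ltW.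
move=> GK GL; move: KL; rewrite le_eqVlt => /predU1P[KL|KL].
  have [_ c1] := rot_shrink L.2 GK; have [_ c2] := rot_shrink K.2 GL.
  by move: c2; rewrite -KL addnC => c2; exact: (cong_trans MP (cong_sym MP c1) c2).
have [j jP] : exists j, t ^+ j < L.1 - K.1 by apply: expt_small; rewrite subr_gt0.
have [GK' c] := rot_shrink j GK.
have d : disj L (K.1, (K.2 + j)%N).
  rewrite disj_sym /disj /=; apply/orP; left.
  by have := expt_le R (leq_addl K.2 j); lra.
exact: (cong_trans MP (cong_sym MP c) (rot_cong_disj GL GK' d)).
Qed.

Definition unit_itv : itv := (0, 0%N).
Lemma golden_unit : golden unit_itv.
Proof. by split; [exact: Ztau0 | rewrite /= | rewrite /= add0r expr0]. Qed.

(** All rotations lie in one coset of the monolith, whose square is trivial;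
    these two cosets therefore form a subgroup, which turns out to be Vtau. *)
Definition swaprot f := Vtau f /\ (M f \/ cong M f (rotation unit_itv)).

Lemma swaprot_rot K : golden K -> swaprot (rotation K).
Proof. by move=> GK; split; [exact: rot_Vtau | right; exact: rot_cong GK golden_unit]. Qed.

Lemma monolith_swaprot f : M f -> swaprot f.
Proof. by move=> Mf; split; [have [] := monolith_Vxz Mf | left]. Qed.

Lemma swaprotM f g : swaprot f -> swaprot g -> swaprot (f * g)%g.
Proof.
move=> [Vf Hf] [Vg Hg]; split; first exact: VtauM.
have M2 : M (rotation unit_itv * rotation unit_itv)%g by have [] := rot_yl golden_unit.
have c1 h : M h -> cong M h 1%g by rewrite /cong invg1 mulg1.
case: Hf => [/c1 cf|cf]; case: Hg => [/c1 cg|cg]; have := congM MP Vf cf cg.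
- by rewrite /cong mulg1 invg1 mulg1; left.
- by rewrite mul1g; right.
- by rewrite mulg1; right.
- by move=> c; left; exact: (cong_mem MP c M2).
Qed.

Lemma swaprotV f : swaprot f -> swaprot (f^-1)%g.
Proof.
move=> [Vf Hf]; have Vf' := VtauV Vf; split=> //.
have M2 : M (rotation unit_itv * rotation unit_itv)%g by have [] := rot_yl golden_unit.
case: Hf => [Mf|cf]; first by left; exact: (normalizedV MP Mf).
right; rewrite /cong -invgM; apply: (normalizedV MP).
apply: (cong_mem MP) M2.
by apply: (congM MP) => //; [exact: rot_Vtau golden_unit | exact: cong_refl MP _].
Qed.

End Kernel.

(** * Tilings *)

Section Tilings.
Variable R : realType.
Local Notation t := (tau R).
Local Notation I01 := (I01 R).
Local Notation itv := (itv R).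
Local Notation unit_itv := (unit_itv R).
Implicit Types (I J K L A B C D : itv) (P Q : seq itv) (f g h : bijection I01).

Definition tiling P := [/\ uniq P, forall I, I \in P -> golden I,
  forall I J, I \in P -> J \in P -> I <> J -> disj I J &
  forall x : I01, exists2 I, I \in P & in_itv I (sval x)].

Definition img f I : itv := xget I [set J | golden J /\ maps f I J]%classic.
Definition affine_on f I := exists2 J, golden J & maps f I J.

Lemma img_eq f I J : golden I -> golden J -> maps f I J -> img f I = J.
Proof.
move=> GI GJ fIJ; have [] := xgetI I (conj GJ fIJ : [set J | golden J /\ maps f I J]%classic J).
by move=> _ h; apply: maps_uniq GI h fIJ.
Qed.

Lemma imgP f I : affine_on f I -> golden (img f I) /\ maps f I (img f I).
Proof. by move=> [J GJ fIJ]; apply: (xgetI I (conj GJ fIJ : [set J | golden J /\ maps f I J]%classic J)). Qed.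

(** Tilings are lists up to permutation, so this says that [f] carries the tiles
    of [P] affinely onto those of [Q] without saying which onto which. *)
Definition matches f P Q :=
  (forall I, I \in P -> golden I /\ affine_on f I) /\ perm_eq (map (img f) P) Q.

Lemma matches_perm f P P' Q Q' : perm_eq P P' -> perm_eq Q Q' -> matches f P Q -> matches f P' Q'.
Proof.
move=> PP QQ [fP fPQ]; split; first by move=> I IP; apply: fP; rewrite (perm_mem PP).
by rewrite perm_sym in PP; apply: perm_trans (perm_map _ PP) (perm_trans fPQ QQ).
Qed.

Lemma matches_comp f g P Q S : matches f P Q -> matches g Q S -> matches (g * f)%g P S.
Proof.
move=> [fP fPQ] [gQ gQS].
have both I : I \in P -> golden (img g (img f I)) /\ maps (g * f)%g I (img g (img f I)).
  move=> IP; have [GI /imgP[GJ fJ]] := fP I IP.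
  have JQ : img f I \in Q by rewrite -(perm_mem fPQ) map_f.
  have [_ /imgP[GK gK]] := gQ _ JQ.
  by split=> //; exact: maps_comp fJ gK.
split; first by move=> I IP; have [GI _] := fP I IP; have [GK m] := both I IP; split=> //; exists (img g (img f I)).
have -> : map (img (g * f)%g) P = map (img g) (map (img f) P).
  rewrite -map_comp; apply/eq_in_map => I IP; have [GI _] := fP I IP.
  by have [GK m] := both I IP; exact: img_eq.
exact: perm_trans (perm_map _ fPQ) gQS.
Qed.

Lemma matches_inv f P Q : matches f P Q -> matches (f^-1)%g Q P.
Proof.
move=> [fP fPQ].
have inv I : I \in P -> golden I /\ maps (f^-1)%g (img f I) I.
  by move=> IP; have [GI /imgP[GJ fJ]] := fP I IP; split=> //; exact: maps_inv.
have gol I : I \in P -> golden (img f I) by move=> /fP[_ /imgP[]].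
split.
  move=> J; rewrite -(perm_mem fPQ) => /mapP[I IP ->]; split; first exact: gol.
  by have [GI m] := inv I IP; exists I.
rewrite perm_sym in fPQ; apply: perm_trans (perm_map _ fPQ) _.
rewrite -map_comp (_ : map _ P = P) //; rewrite -[RHS]map_id; apply/eq_in_map => I IP.
by have [GI m] := inv I IP; apply: img_eq => //; exact: gol.
Qed.

Lemma matches_tiling f P Q : tiling P -> matches f P Q -> tiling Q.
Proof.
move=> [uP GP dP cP] [fP fPQ].
have dI I J : I \in P -> J \in P -> I <> J -> disj (img f I) (img f J).
  move=> IP JP IJ; have [GI /imgP[GI' fI]] := fP I IP; have [GJ /imgP[GJ' fJ]] := fP J JP.
  by apply: (maps_disj GI GJ fI fJ GI'); exact: dP.
have nd I : golden I -> ~ disj I I.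
  by move=> GI; rewrite /disj orbb => h; have := expt_gt0 R I.2; lra.
split.
- rewrite -(perm_uniq fPQ) map_inj_in_uniq // => I J IP JP e; apply: contrapT => IJ.
  by have := dI I J IP JP IJ; rewrite e; apply: nd; have [_ /imgP[]] := fP J JP.
- by move=> J; rewrite -(perm_mem fPQ) => /mapP[I IP ->]; have [_ /imgP[]] := fP I IP.
- move=> J J'; rewrite -!(perm_mem fPQ) => /mapP[I IP ->] /mapP[I' IP' ->] ne.
  by apply: dI => // e; apply: ne; rewrite e.
- move=> y; have [I IP xI] := cP (bij_inv f y).
  exists (img f I); first by rewrite -(perm_mem fPQ) map_f.
  by have [GI /imgP[_ fI]] := fP I IP; have := maps_in fI xI; rewrite [f _]bij_invK.
Qed.

Lemma tiling_perm P Q : perm_eq P Q -> tiling P -> tiling Q.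
Proof.
move=> PQ [uP GP dP cP]; have m := perm_mem PQ; split.
- by rewrite -(perm_uniq PQ).
- by move=> I; rewrite -m; exact: GP.
- by move=> I J; rewrite -!m; exact: dP.
- by move=> x; have [I IP xI] := cP x; exists I; rewrite -?m.
Qed.

Lemma golden_disj_neq I J : golden I -> disj I J -> I <> J.
Proof.
by move=> GI + IJ; rewrite -IJ /disj orbb => h; have := expt_gt0 R I.2; lra.
Qed.

Lemma tiling_split I P : tiling (I :: P) -> tiling (xl I :: xr I :: P).
Proof.
move=> [/= /andP[nIP uP] GP dP cP]; have GI := GP I (mem_head _ _).
have [Gl Gr] := conj (golden_xl GI) (golden_xr GI).
have s := disj_sym (R := R).
have dIP J : J \in P -> disj I J.
  move=> JP; apply: dP; rewrite ?mem_head ?inE ?JP ?orbT //.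
  by move=> e; move: nIP; rewrite e JP.
have dl J : J \in P -> disj (xl I) J by move=> /dIP; apply: disj_sub (sub_xl I).
have dr J : J \in P -> disj (xr I) J by move=> /dIP; apply: disj_sub (sub_xr I).
have nl : xl I \notin P by apply/negP => h; exact: (golden_disj_neq Gl (dl _ h)).
have nr : xr I \notin P by apply/negP => h; exact: (golden_disj_neq Gr (dr _ h)).
split.
- rewrite /= inE negb_or nl nr uP !andbT; apply/eqP.
  exact: golden_disj_neq Gl (disj_x I).
- by move=> J; rewrite !inE => /or3P[/eqP->|/eqP->|JP] //; apply: GP; rewrite inE JP orbT.
- move=> J K; rewrite !inE => /or3P[/eqP->|/eqP->|JP] /or3P[/eqP->|/eqP->|KP] ne //.
  + exact: disj_x.
  + exact: dl.
  + by rewrite s disj_x.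
  + exact: dr.
  + by rewrite s dl.
  + by rewrite s dr.
  + by apply: dP; rewrite ?inE ?JP ?KP ?orbT.
- move=> x; have [J] := cP x; rewrite inE => /predU1P[->|JP] xJ.
    by move: xJ; rewrite in_itv_x => /orP[] xJ; [exists (xl I) | exists (xr I)]; rewrite ?inE ?eqxx ?orbT.
  by exists J; rewrite // !inE JP !orbT.
Qed.

Lemma tiling_unit : tiling [:: unit_itv].
Proof.
split=> //.
- by move=> I; rewrite inE => /eqP ->; exact: golden_unit.
- by move=> I J; rewrite !inE => /eqP -> /eqP ->.
- move=> x; exists unit_itv; rewrite ?mem_head //.
  by rewrite /in_itv /= add0r expr0; exact: svalP.
Qed.

(** The sets of leaves of the trees of x-carets, listed in any order. *)
Inductive xtree : seq itv -> Prop :=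
| xtree_unit : xtree [:: unit_itv]
| xtree_split I P Q : xtree (I :: P) -> perm_eq Q (xl I :: xr I :: P) -> xtree Q.

Lemma xtree_tiling P : xtree P -> tiling P.
Proof.
elim=> [|I Q S _ IH e]; first exact: tiling_unit.
by rewrite perm_sym in e; apply: tiling_perm e (tiling_split IH).
Qed.

Lemma xtree_perm P Q : perm_eq P Q -> xtree P -> xtree Q.
Proof.
move=> PQ xP; case: xP PQ => [|I P' Q' xP e] PQ.
  by move: PQ; rewrite perm_sym => /perm_small_eq -> //; exact: xtree_unit.
by apply: xtree_split xP _; apply: perm_trans e; rewrite perm_sym.
Qed.

Lemma affine_on_xl f I : affine_on f I -> affine_on f (xl I).
Proof. by move=> [J GJ m]; exists (xl J); [exact: golden_xl | exact: maps_xl]. Qed.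
Lemma affine_on_xr f I : affine_on f I -> affine_on f (xr I).
Proof. by move=> [J GJ m]; exists (xr J); [exact: golden_xr | exact: maps_xr]. Qed.
Lemma img_xl f I : golden I -> affine_on f I -> img f (xl I) = xl (img f I).
Proof.
move=> GI /imgP[GJ m]; apply: img_eq; [exact: golden_xl | exact: golden_xl | exact: maps_xl].
Qed.
Lemma img_xr f I : golden I -> affine_on f I -> img f (xr I) = xr (img f I).
Proof.
move=> GI /imgP[GJ m]; apply: img_eq; [exact: golden_xr | exact: golden_xr | exact: maps_xr].
Qed.

Lemma matches_split f I P Q : matches f (I :: P) Q ->
  exists J Q', [/\ perm_eq Q (J :: Q') & matches f (xl I :: xr I :: P) (xl J :: xr J :: Q')].
Proof.
move=> [fP fPQ]; exists (img f I), (map (img f) P).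
have [GI aI] := fP I (mem_head _ _); rewrite perm_sym in fPQ; split=> //; split.
  move=> K; rewrite !inE => /or3P[/eqP->|/eqP->|KP].
  - by split; [exact: golden_xl | exact: affine_on_xl].
  - by split; [exact: golden_xr | exact: affine_on_xr].
  - by apply: fP; rewrite inE KP orbT.
by rewrite /= img_xl // img_xr.
Qed.

End Tilings.

(** * Elements that match tilings *)

Section Factorization.
Variables (R : realType) (phi : bijection (I01 R) -> 'Z_2).
Hypothesis phiP : is_varphi phi.
Local Notation t := (tau R).
Local Notation I01 := (I01 R).
Local Notation itv := (itv R).
Local Notation unit_itv := (unit_itv R).
Implicit Types (I J K L A B C D X Y Z : itv) (P Q : seq itv) (f g h : bijection I01).
Local Notation H := (swaprot phi).

Lemma swaprot1 : H 1%g.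
Proof.
apply: (monolith_swaprot phiP).
exact: normalized1 (monolith_normalized phiP).
Qed.

(** The swap of the two tiles does it. *)
Lemma move_tile Q X Y : tiling Q -> X \in Q -> Y \in Q ->
  exists m, [/\ H m, matches m Q Q, img m X = Y &
    forall Z, Z \in Q -> Z <> X -> Z <> Y -> img m Z = Z].
Proof.
move=> [uQ GQ dQ _] XQ YQ; have GX := GQ X XQ; have GY := GQ Y YQ.
have [<-|/eqP ne] := eqVneq X Y.
  have m1 I : maps (1%g : bijection I01) I I by apply: maps_fix.
  have i1 I : I \in Q -> img (1%g : bijection I01) I = I.
    by move=> IQ; apply: img_eq; auto.
  exists 1%g; split; [exact: swaprot1 | | exact: i1 | by move=> Z ZQ _ _; exact: i1].
  split; first by move=> I IQ; split; [exact: GQ | exists I; [exact: GQ | exact: m1]].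
  by rewrite (_ : map _ Q = Q) // -[RHS]map_id; apply/eq_in_map.
have d := dQ _ _ XQ YQ ne.
have mX := swap_l GX GY d; have mY := swap_r GX GY d.
have mZ Z : Z \in Q -> Z <> X -> Z <> Y -> maps (swap X Y) Z Z.
  by move=> ZQ ZX ZY; apply: swap_fix => //; exact: dQ.
have iX : img (swap X Y) X = Y by exact: img_eq.
have iY : img (swap X Y) Y = X by exact: img_eq.
have iZ Z : Z \in Q -> Z <> X -> Z <> Y -> img (swap X Y) Z = Z.
  by move=> ZQ ZX ZY; apply: img_eq; auto.
have all Z : Z \in Q -> [/\ img (swap X Y) Z \in Q, affine_on (swap X Y) Z &
    img (swap X Y) (img (swap X Y) Z) = Z].
  move=> ZQ; have [->|/eqP ZX] := eqVneq Z X; first by rewrite iX iY; split=> //; exists Y.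
  have [->|/eqP ZY] := eqVneq Z Y; first by rewrite iY iX; split=> //; exists X.
  by rewrite !iZ //; split=> //; exists Z; auto.
exists (swap X Y); split=> //.
  by apply: (monolith_swaprot phiP); exact: monolith_swap.
split; first by move=> Z ZQ; have [_ aZ _] := all Z ZQ; split=> //; exact: GQ.
apply: uniq_perm => //.
  rewrite map_inj_in_uniq // => Z W ZQ WQ e.
  by have [_ _ <-] := all Z ZQ; have [_ _ <-] := all W WQ; rewrite e.
move=> Z; apply/mapP/idP => [[W WQ ->]|ZQ]; first by have [] := all W WQ.
by have [iQ _ e] := all Z ZQ; exists (img (swap X Y) Z).
Qed.

(** Both trees end with a caret; moving tiles in the target, the element maps
    one caret onto the other, and both carets can be removed. *)
Lemma xtree_matches P Q f : xtree P -> xtree Q -> Vtau f -> matches f P Q -> H f.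
Proof.
move=> xP; elim: xP Q f => [|I P1 P' xP1 IH eP] Q f xQ Vf fPQ.
  case: xQ fPQ => [|J Q1 Q' xQ eQ] [fP fPQ]; last first.
    by have := perm_size fPQ; rewrite (perm_size eQ).
  have [_ /imgP[_ m]] := fP unit_itv (mem_head _ _).
  have iE : img f unit_itv = unit_itv.
    by move/perm_mem: fPQ => /(_ unit_itv); rewrite !inE eqxx => /eqP.
  rewrite iE in m; suff -> : f = 1%g by exact: swaprot1.
  apply: bijectionP => x; apply: val_inj => /=; rewrite m ?aff_id //.
  by rewrite /in_itv /= add0r expr0; exact: svalP.
case: xQ fPQ => [|J Q1 Q' xQ eQ] fPQ.
  by have [_ e] := fPQ; have := perm_size e; rewrite size_map (perm_size eP).
have {}fPQ := matches_perm eP eQ fPQ.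
set PP := _ :: _ in fPQ; set QQ := _ :: _ in fPQ.
have tQ : tiling QQ := tiling_split (xtree_tiling xQ).
have [uQ _ _ _] := tQ.
have inQ g K : matches g PP QQ -> K \in PP -> img g K \in QQ.
  by move=> [_ e] KP; rewrite -(perm_mem e) map_f.
have lP : xl I \in PP by rewrite mem_head.
have rP : xr I \in PP by rewrite inE mem_head orbT.
have lQ : xl J \in QQ by rewrite mem_head.
have rQ : xr J \in QQ by rewrite inE mem_head orbT.
have icomp g m K : matches g PP QQ -> matches m QQ QQ -> K \in PP ->
    img (m * g)%g K = img m (img g K).
  move=> gPQ mQ KP; have [/(_ K KP)[GK /imgP[GK' gK]] _] := gPQ.
  have [/(_ _ (inQ _ _ gPQ KP))[_ /imgP[GK'' mK]] _] := mQ.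
  by apply: img_eq => //; exact: maps_comp gK mK.
have [m1 [Hm1 mm1 im1 _]] := move_tile tQ (inQ _ _ fPQ lP) lQ.
have f1PQ := matches_comp fPQ mm1.
have i1 : img (m1 * f)%g (xl I) = xl J by rewrite icomp.
have [m2 [Hm2 mm2 im2 fix2]] := move_tile tQ (inQ _ _ f1PQ rP) rQ.
have f2PQ := matches_comp f1PQ mm2.
have i2r : img (m2 * (m1 * f))%g (xr I) = xr J by rewrite icomp.
have lrJ : xl J <> xr J.
  by move: uQ; rewrite /= inE negb_or -!andbA => /and3P[/eqP].
have i2l : img (m2 * (m1 * f))%g (xl I) = xl J.
  rewrite icomp // i1 fix2 // => e; apply: lrJ.
  have [_ eperm] := f1PQ.
  have uP : uniq (map (img (m1 * f)%g) PP) by rewrite (perm_uniq eperm).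
  move: uP; rewrite /= inE negb_or -!andbA => /and3P[/eqP ne _ _].
  by case: ne; rewrite i1 e.
have Hm : H (m2 * (m1 * f))%g.
  have GJ : golden J by have [_ G _ _] := xtree_tiling xQ; apply: G; exact: mem_head.
  have GI : golden I by have [_ G _ _] := xtree_tiling xP1; apply: G; exact: mem_head.
  have [f2P f2perm] := f2PQ.
  have mIJ : maps (m2 * (m1 * f))%g I J.
    apply: maps_x.
      by have [_ /imgP[_]] := f2P _ lP; rewrite i2l.
    by have [_ /imgP[_]] := f2P _ rP; rewrite i2r.
  have iIJ := img_eq GI GJ mIJ.
  apply: (IH (J :: Q1)) => //.
    apply: VtauM; first by case: Hm2.
    by apply: VtauM => //; case: Hm1.
  split.
    move=> K; rewrite inE => /predU1P[->|KP]; first by split=> //; exists J.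
    by apply: f2P; rewrite !inE KP !orbT.
  move: f2perm; rewrite /PP /QQ /= i2l i2r iIJ !perm_cons.
  by [].
have -> : f = (m1^-1 * (m2^-1 * (m2 * (m1 * f))))%g by rewrite mulKg mulKg.
by apply: (swaprotM phiP); [exact: (swaprotV phiP) | apply: (swaprotM phiP) => //; exact: (swaprotV phiP)].
Qed.

(** Being the leaves of an x-tree is destroyed by the rotations that reorder a
    tiling. This weaker property is stable under them, and under cutting. *)
Definition straight P := exists h Q, [/\ H h, xtree Q & matches h P Q].

Lemma straight_perm P P' : perm_eq P P' -> straight P -> straight P'.
Proof. by move=> PP [h [Q [Hh xQ m]]]; exists h, Q; split=> //; exact: matches_perm m. Qed.

Lemma straight_tiling P : straight P -> tiling P.
Proof.
by move=> [h [Q [_ /xtree_tiling tQ /matches_inv m]]]; exact: matches_tiling tQ m.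
Qed.

Lemma straight_split I P : straight (I :: P) -> straight (xl I :: xr I :: P).
Proof.
move=> [h [Q [Hh xQ m]]]; have [J [Q' [e m']]] := matches_split m.
exists h, (xl J :: xr J :: Q'); split=> //.
exact: xtree_split (xtree_perm e xQ) (perm_refl _).
Qed.

Lemma straight_pull h P Q : H h -> matches h P Q -> straight Q -> straight P.
Proof.
move=> Hh m [g [S [Hg xS mg]]]; exists (g * h)%g, S; split=> //.
  exact: (swaprotM phiP).
exact: matches_comp m mg.
Qed.

(** Conjugated to x-trees on both sides, [f] is covered by [xtree_matches]. *)
Lemma straight_matches f P Q : straight P -> straight Q -> Vtau f -> matches f P Q -> H f.
Proof.
move=> [h [S [Hh xS mh]]] [g [T [Hg xT mg]]] Vf m.
have Vh : Vtau h by case: Hh.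
have Vg : Vtau g by case: Hg.
have HH : H (g * (f * h^-1))%g.
  apply: (xtree_matches xS xT); first by apply: VtauM => //; apply: VtauM => //; exact: VtauV.
  by apply: matches_comp mg; apply: matches_comp m; exact: matches_inv.
have -> : f = (g^-1 * (g * (f * h^-1)) * h)%g by rewrite mulKg mulgKV.
by apply: (swaprotM phiP) => //; apply: (swaprotM phiP) => //; exact: (swaprotV phiP).
Qed.

End Factorization.

(** * Tilings with two consecutive lengths *)

Section Words.
Variable R : realType.
Local Notation t := (tau R).
Local Notation I01 := (I01 R).
Local Notation itv := (itv R).
Local Notation unit_itv := (unit_itv R).
Implicit Types (I J K L : itv) (P Q : seq itv) (f g h : bijection I01) (w u v : seq bool).

(** The word [w] lays intervals of lengths [t ^+ N] (false) and [t ^+ N.+1]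
    (true) side by side, starting at [a]. *)
Fixpoint wlen (N : nat) w : R := if w is b :: w' then t ^+ (N + b) + wlen N w' else 0.
Fixpoint tiles (N : nat) (a : R) w : seq itv :=
  if w is b :: w' then (a, (N + b)%N) :: tiles N (a + t ^+ (N + b)) w' else [::].

Lemma wlen_cat N u v : wlen N (u ++ v) = wlen N u + wlen N v.
Proof. by elim: u => [|b u IH] /=; rewrite ?add0r // IH addrA. Qed.

Lemma tiles_cat N a u v : tiles N a (u ++ v) = tiles N a u ++ tiles N (a + wlen N u) v.
Proof. by elim: u a => [|b u IH] a /=; rewrite ?addr0 // IH addrA. Qed.

Lemma wlen_count N w :
  wlen N w = (count_mem false w)%:R * t ^+ N + (count_mem true w)%:R * t ^+ N.+1.
Proof.
elim: w => [|b w IH] /=; first by rewrite !mul0r addr0.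
by case: b; rewrite IH /= ?addn0 ?addn1 add0n natrD; ring.
Qed.

Lemma wlen_ge0 N w : 0 <= wlen N w.
Proof. by elim: w => //= b w IH; apply: addr_ge0 => //; exact/ltW/expt_gt0. Qed.

Lemma Ztau_wlen N w : Ztau (wlen N w).
Proof. by elim: w => [|b w IH] /=; [exact: Ztau0 | apply: ZtauD => //; exact: Ztau_expt]. Qed.

(** The equality of lengths is an equality between integers because [t] is
    irrational. *)
Lemma wlen_perm N w w' : wlen N w = wlen N w' -> perm_eq w w'.
Proof.
rewrite !wlen_count !exprS => e; have T := expt_neq0 R N.
set a := count_mem false w in e; set b := count_mem true w in e.
set a' := count_mem false w' in e; set b' := count_mem true w' in e.
have [e1 e2] : a%:Z - a'%:Z = 0 /\ b%:Z - b'%:Z = 0.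
  apply: (@tau_irrational R); rewrite !rmorphB /=.
  apply: (mulIf T); rewrite mul0r.
  have -> : (a%:~R - a'%:~R + (b%:~R - b'%:~R) * t) * t ^+ N =
    (a%:R * t ^+ N + b%:R * (t * t ^+ N)) - (a'%:R * t ^+ N + b'%:R * (t * t ^+ N)) :> R by ring.
  by rewrite e subrr.
by apply/allP => -[] _ /=; apply/eqP; rewrite -/a -/a' -/b -/b'; lia.
Qed.

Lemma tiles_bounds N a w I : I \in tiles N a w ->
  [/\ a <= I.1, I.1 + t ^+ I.2 <= a + wlen N w & Ztau a -> Ztau I.1].
Proof.
elim: w a => //= b w IH a; rewrite inE => /predU1P[->|/IH[h1 h2 h3]] /=.
  by split=> //; rewrite addrA lerDl wlen_ge0.
have T := expt_gt0 R (N + b); split; [lra | lra |].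
by move=> Z; apply: h3; apply: ZtauD => //; exact: Ztau_expt.
Qed.

(** The interval that starts at [a] gives the first letter; remove it and go on
    at its right end. *)
Lemma tiles_of_tiling N n (a : R) Q : size Q = n -> 0 <= a <= 1 ->
  (forall I, I \in Q -> golden I /\ exists b : bool, I.2 = (N + b)%N) -> uniq Q ->
  (forall I J, I \in Q -> J \in Q -> I <> J -> disj I J) ->
  (forall x, 0 < x <= 1 -> (a < x) = has (fun I => in_itv I x) Q) ->
  exists2 w, a + wlen N w = 1 & perm_eq Q (tiles N a w).
Proof.
elim: n a Q => [|n IH] a Q sQ /andP[a0 a1] GQ uQ dQ cov.
  have Q0 : Q = [::] by case: Q sQ {GQ uQ dQ cov}.
  exists [::]; last by rewrite Q0.
  have := cov 1; rewrite ltr01 lexx Q0 /= => /(_ erefl) h.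
  by rewrite addr0; apply/eqP; rewrite eq_le a1 leNgt h.
have alt1 : a < 1.
  rewrite lt_neqAle a1 andbT; apply/eqP => aE.
  case: Q sQ GQ cov {uQ dQ} => // I Q _ GQ cov.
  have [GI _] := GQ I (mem_head _ _); have [x xE] := golden_pt GI.
  have : has (fun I => in_itv I (sval x)) (I :: Q).
    by rewrite /= /in_itv xE lexx ltrDl expt_gt0.
  by rewrite -cov ?svalP // aE ltNge; have /andP[_ ->] := svalP x.
have ge_a I : I \in Q -> a <= I.1.
  move=> IQ; rewrite leNgt; apply/negP => lt; have [[_ I0 I1] _] := GQ I IQ.
  have T := expt_gt0 R I.2.
  pose x := Num.min a (I.1 + t ^+ I.2).
  have [x1 x2] : x <= a /\ x <= I.1 + t ^+ I.2 by rewrite !ge_min !lexx orbT.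
  have x3 : I.1 < x by rewrite lt_min lt ltrDl T.
  have := cov x; rewrite [a < x]ltNge x1 /= => h.
  have /esym/hasPn/(_ I IQ) : false = has (fun I => in_itv I x) Q by apply: h; apply/andP; split; lra.
  by rewrite /in_itv x3 x2.
have [I IQ Ia] : exists2 I, I \in Q & I.1 = a.
  have /hasP[I0 I0Q _] : has (fun I => in_itv I 1) Q by rewrite -cov ?alt1 // ltr01 lexx.
  (* Otherwise the least left end leaves a gap after [a]. *)
  apply: contrapT => no.
  have gt_a I : I \in Q -> a < I.1.
    by move=> IQ; rewrite lt_neqAle ge_a // andbT; apply/eqP => e; apply: no; exists I.
  have [x [x1 x2 x3]] : exists x, [/\ a < x, x <= 1 & forall I, I \in Q -> x <= I.1].
    elim: Q gt_a {IH sQ GQ uQ dQ cov ge_a I0 I0Q no} => [|I Q IHQ] gt_a.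
      by exists 1; split.
    have [|x [x1 x2 x3]] := IHQ; first by move=> J JQ; apply: gt_a; rewrite inE JQ orbT.
    have aI := gt_a I (mem_head _ _).
    exists (Num.min x I.1); split; first by rewrite lt_min x1 aI.
      by rewrite ge_min x2.
    move=> J; rewrite inE => /predU1P[->|/x3 h]; first by rewrite ge_min lexx orbT.
    by rewrite ge_min h.
  have := cov x; rewrite x1 => /(_ _)/esym/hasP[|J JQ]; first by apply/andP; split; lra.
  by rewrite /in_itv ltNge x3.
have [GI [b bE]] := GQ I IQ; have T := expt_gt0 R I.2.
have pQ := perm_to_rem IQ.
have uR : uniq (I :: rem I Q) by rewrite -(perm_uniq pQ).
have remQ J : J \in rem I Q -> J \in Q /\ disj I J.
  move=> JR; have JQ := mem_rem JR; split=> //; apply: dQ => // e.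
  by move: uR => /= /andP[/negP h _]; apply: h; rewrite {1}e.
have [||||||w wE wP] := IH (I.1 + t ^+ I.2) (rem I Q).
- by rewrite size_rem // sQ.
- by have [_ ? ?] := GI; apply/andP; split; lra.
- by move=> J /remQ[JQ _]; exact: GQ.
- by rewrite rem_uniq.
- by move=> J K /remQ[JQ _] /remQ[KQ _]; exact: dQ.
- move=> x x01; have := cov x x01; rewrite (perm_has _ pQ) /=.
  case xI: (in_itv I x) => /= ax.
    case/andP: xI => xI1 xI2; rewrite ltNge xI2 /=; symmetry; apply/hasPn => J /remQ[_ d].
    by rewrite (disj_in d) // /in_itv xI1 xI2.
  rewrite -ax; apply/idP/idP => h; first by lra.
  by move: xI; rewrite /in_itv Ia h /= ltNge => /negbT ->.
exists (b :: w); first by rewrite /= -bE addrA -Ia.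
apply: perm_trans pQ _; rewrite /= -bE -Ia.
have -> : (I.1, I.2) = I by case: (I).
by rewrite perm_cons.
Qed.

(** Cutting each long interval by an x-caret leads from one level to the next. *)
Definition cut_long w := flatten [seq if b then [:: false] else [:: true; false] | b <- w].

Lemma xtree_subst N P a w : xtree (P ++ tiles N a w) -> xtree (P ++ tiles N.+1 a (cut_long w)).
Proof.
elim: w P a => [|b w IH] P a //=.
case: b => /=; rewrite ?addn0 ?addn1 => x.
  rewrite -cat1s catA; apply: IH; by rewrite -catA.
have -> : P ++ [:: (a, N.+2), (a + t ^+ N.+2, N.+1) & tiles N.+1 (a + t ^+ N.+2 + t ^+ N.+1) (cut_long w)] =
   (P ++ [:: (a, N.+2); (a + t ^+ N.+2, N.+1)]) ++ tiles N.+1 (a + t ^+ N.+2 + t ^+ N.+1) (cut_long w).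
  by rewrite -catA.
rewrite -addrA [t ^+ N.+2 + _]addrC -expt_split; apply: IH.
have {}x : xtree ((a, N) :: P ++ tiles N (a + t ^+ N) w).
  by apply: xtree_perm x; rewrite perm_catC /= perm_cons perm_catC.
apply: xtree_split x _.
by rewrite -catA perm_catC /= !perm_cons perm_catC.
Qed.

Lemma wlen_subst N w : wlen N.+1 (cut_long w) = wlen N w.
Proof.
elim: w => //= b w IH; case: b; rewrite /= ?addn0 ?addn1 IH // addrA; congr (_ + _).
by rewrite [RHS]expt_split addrC.
Qed.

Fixpoint standard_word N := if N is N'.+1 then cut_long (standard_word N') else [:: false].

Lemma xtree_standard N : xtree (tiles N 0 (standard_word N)).
Proof.
elim: N => [|N IH]; first exact: xtree_unit.
by rewrite -[tiles _ _ _]cat0s; apply: (xtree_subst (P := [::])).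
Qed.

Lemma wlen_standard N : wlen N (standard_word N) = 1.
Proof. by elim: N => [|N IH] /=; rewrite ?wlen_subst // expr0 addr0. Qed.

(** Exchanges of neighbours bring the first letter of [w] to its place in [w'];
    recurse on the other letters. *)
Lemma perm_adjacent (G : seq bool -> Prop) :
  (forall u b c v, G (u ++ [:: b, c & v]) -> G (u ++ [:: c, b & v])) ->
  forall w w', perm_eq w w' -> G w -> G w'.
Proof.
move=> adj w w' ww; rewrite -[w]cat0s -[w']cat0s.
elim: w w' [::] ww => [|b w IH] w' u ww.
  by move: ww; rewrite perm_sym => /perm_nilP ->.
have bw' : b \in w' by rewrite -(perm_mem ww) mem_head.
case/splitPr: bw' ww => p1 p2 ww Gw.
have {}ww : perm_eq w (p1 ++ p2).
  by move: ww; rewrite perm_sym perm_catC /= perm_cons perm_catC perm_sym.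
have {}Gw : G (u ++ b :: p1 ++ p2).
  by rewrite -cat_rcons; apply: IH ww _; rewrite cat_rcons.
elim: p1 u Gw {ww} => [|c p1 IHp] u //= Gw.
by rewrite -cat_rcons; apply: IHp; rewrite cat_rcons; exact: adj.
Qed.

End Words.

(** * Generation by swaps and rotations *)

Section Main.
Variables (R : realType) (phi : bijection (I01 R) -> 'Z_2).
Hypothesis phiP : is_varphi phi.
Local Notation t := (tau R).
Local Notation I01 := (I01 R).
Local Notation itv := (itv R).
Implicit Types (I J K L A B C D X Y Z : itv) (P Q : seq itv) (f g h : bijection I01) (u v w : seq bool).
Local Notation H := (swaprot phi).
Local Notation straight := (straight phi).

(** [K] is the union of a short interval and the long one to its right, the two
    halves cut by an x-caret; its rotation puts the long one first. *)
Lemma rot_matches N u v (K := (wlen R N.+1 u, N)) :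
  wlen R N.+1 (u ++ [:: true, false & v]) = 1 ->
  golden K /\ matches (rotation K) (tiles N.+1 0 (u ++ [:: true, false & v]))
                  (tiles N.+1 0 (u ++ [:: false, true & v])).
Proof.
move=> w1; set a := wlen R N.+1 u in K *.
have Kr : a + t ^+ N.+2 + t ^+ N.+1 = a + t ^+ N.
  by rewrite -addrA [t ^+ N.+2 + _]addrC -expt_split.
have wE : a + t ^+ N + wlen R N.+1 v = 1.
  by rewrite -w1 wlen_cat /= ?addn0 ?addn1 !addrA Kr.
have v0 := wlen_ge0 R N.+1 v.
have GK : golden K by split; rewrite /=; [exact: Ztau_wlen | exact: wlen_ge0 | lra].
split=> //.
have [rl rr _] := rotP GK.
have [Gxl Gxr] := conj (golden_xl GK) (golden_xr GK).
have [Gyl Gyr] := conj (golden_yl GK) (golden_yr GK).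
rewrite !tiles_cat /= -/a add0r addn0 addn1 Kr.
have -> : a + t ^+ N.+1 + t ^+ N.+2 = a + t ^+ N by rewrite -addrA -expt_split.
have fixu I : I \in tiles N.+1 0 u -> golden I /\ maps (rotation K) I I.
  move=> IU; have [h1 h2 h3] := tiles_bounds IU; rewrite -/a in h2.
  have GI : golden I by split=> //; [exact/h3/Ztau0 | move: (expt_gt0 R N); lra].
  by split=> //; apply: rot_fix => //; rewrite /disj /=; apply/orP; left; lra.
have fixv I : I \in tiles N.+1 (a + t ^+ N) v -> golden I /\ maps (rotation K) I I.
  move=> IU; have [h1 h2 h3] := tiles_bounds IU.
  have aN0 : 0 <= a + t ^+ N by apply: addr_ge0; [exact: wlen_ge0 | exact/ltW/expt_gt0].
  have GI : golden I.
    split; [apply: h3 | lra | lra].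
    by apply: ZtauD; [exact: Ztau_wlen | exact: Ztau_expt].
  by split=> //; apply: rot_fix => //; rewrite /disj /=; apply/orP; right.
have aff I J : golden I -> golden J -> maps (rotation K) I J -> golden I /\ affine_on (rotation K) I.
  by move=> GI GJ m; split=> //; exists J.
split.
  move=> I; rewrite mem_cat !inE => /or4P[/fixu[GI m]|/eqP->|/eqP->|/fixv[GI m]].
  - exact: aff m.
  - exact: aff rl.
  - exact: aff rr.
  - exact: aff m.
rewrite map_cat /=.
have -> : map (img (rotation K)) (tiles N.+1 0 u) = tiles N.+1 0 u.
  by rewrite -[RHS]map_id; apply/eq_in_map => I /fixu[GI m]; exact: img_eq.
have -> : map (img (rotation K)) (tiles N.+1 (a + t ^+ N) v) = tiles N.+1 (a + t ^+ N) v.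
  by rewrite -[RHS]map_id; apply/eq_in_map => I /fixv[GI m]; exact: img_eq.
rewrite -[(a, N.+2)]/(xl K) -[(a + t ^+ N.+2, N.+1)]/(xr K).
rewrite (img_eq Gxl Gyr rl) (img_eq Gxr Gyl rr) perm_cat2l.
by rewrite -[[:: yr K, yl K & _]]/([:: yr K] ++ [:: yl K] ++ _) perm_catCA.
Qed.

(** Rotations carry the word to the standard word, which is an x-tree. *)
Lemma straight_tiles N w : wlen R N.+1 w = 1 -> straight (tiles N.+1 0 w).
Proof.
move=> w1; pose G w := wlen R N.+1 w = 1 -> straight (tiles N.+1 0 w).
suff : G w by apply.
apply: (@perm_adjacent G _ (standard_word N.+1)); last 2 first.
- by apply: (@wlen_perm R N.+1); rewrite w1 wlen_standard.
- move=> _; exists 1%g, (tiles N.+1 0 (standard_word N.+1)).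
  have x := xtree_standard R N.+1; have [_ GP _ _] := xtree_tiling x.
  have m1 I : maps (1%g : bijection I01) I I by apply: maps_fix.
  split=> //; first exact: swaprot1 phiP.
  split; first by move=> I IP; split; [exact: GP | exists I; [exact: GP | exact: m1]].
  rewrite (_ : map _ _ = tiles N.+1 0 (standard_word N.+1)) // -[RHS]map_id.
  by apply/eq_in_map => I IP; apply: img_eq => //; exact: GP.
move=> u b c v Gw e.
have e' : wlen R N.+1 (u ++ [:: b, c & v]) = 1 by rewrite -e !wlen_cat /=; congr (_ + _); exact: addrCA.
have {Gw} sw := Gw e'; case: b c e e' sw => [] [] // e e' sw.
  have [GK m] := rot_matches e'.
  apply: (straight_pull phiP _ (matches_inv m)) => //.
  by apply: (swaprotV phiP); exact: swaprot_rot.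
have [GK m] := rot_matches e.
by apply: (straight_pull phiP _ m) => //; exact: swaprot_rot.
Qed.

Lemma weight_halves N k : (k < N)%N ->
  (2 ^ (N.+1 - k.+2) + 2 ^ (N.+1 - k.+1) < 2 ^ (N.+1 - k))%N.
Proof.
move=> /subnK <-; set d := (N - k.+1)%N.
have -> : ((d + k.+1).+1 - k.+2 = d)%N by lia.
have -> : ((d + k.+1).+1 - k.+1 = d.+1)%N by lia.
have -> : ((d + k.+1).+1 - k = d.+2)%N by lia.
rewrite !expnS; have := expn_gt0 2 d; lia.
Qed.

(** Cut, simultaneously in the source and in the target, a tile of the target
    that is too long; the weight [2 ^ (N.+1 - k)] of a tile of length [t ^+ k]
    exceeds that of its two halves together. *)
Lemma straight_refine f N P : straight P -> (forall I, I \in P -> affine_on f I) ->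
  (forall I, I \in P -> ((img f I).2 <= N.+1)%N) ->
  exists P', [/\ straight P', forall I, I \in P' -> affine_on f I &
    forall I, I \in P' -> exists b : bool, (img f I).2 = (N + b)%N].
Proof.
pose weight P := (\sum_(I <- P) 2 ^ (N.+1 - (img f I).2))%N.
have [n] := ubnP (weight P); elim: n P => // n IH P wn sP aP lP.
have [/hasP[I IP short]|/hasPn long] := boolP (has (fun I => (img f I).2 < N)%N P); last first.
  exists P; split=> // I IP; have := long I IP; rewrite -leqNgt => h1; have h2 := lP I IP.
  by exists (N < (img f I).2)%N; lia.
have pP := perm_to_rem IP; set P0 := rem I P in pP.
have inP J : J \in P0 -> J \in P by move=> JP; rewrite (perm_mem pP) inE JP orbT.
have [_ GP _ _] := straight_tiling sP; have GI := GP I IP; have aI := aP I IP.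
have [il ir] := conj (img_xl GI aI) (img_xr GI aI).
apply: (IH (xl I :: xr I :: P0)).
- rewrite -ltnS; apply: leq_trans wn; rewrite ltnS /weight (perm_big _ pP) !big_cons.
  by rewrite addnA ltn_add2r il ir; exact: weight_halves.
- by apply: straight_split; exact: straight_perm pP sP.
- move=> J; rewrite !inE => /or3P[/eqP->|/eqP->|JP]; last exact/aP/inP.
    exact: affine_on_xl.
  exact: affine_on_xr.
- move=> J; rewrite !inE => /or3P[/eqP->|/eqP->|JP]; last exact/lP/inP.
    by rewrite il /=; lia.
  by rewrite ir /=; lia.
Qed.

(** Cut each of the intervals between break points into pieces of lengths
    [t ^+ N.+1] and [t ^+ N.+2], for one large [N]. *)
Lemma Vtau_straight_source f : Vtau f ->
  exists2 P, straight P & forall I, I \in P -> affine_on f I.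
Proof.
move=> /Vtau_chain[n [a [k [c [a0 an aS Za fP]]]]].
have am := chain_mono aS.
have [N NP] : exists N, forall i, (i < n)%N -> exists p q : nat,
    a i.+1 - a i = p%:R * t ^+ N.+1 + q%:R * t ^+ N.+2.
  suff [N NP] : exists N, forall N', (N <= N')%N -> forall i, (i < n)%N -> exists p q : nat,
      a i.+1 - a i = p%:R * t ^+ N' + q%:R * t ^+ N'.+1.
    by exists N => i iN; apply: NP.
  have : (n <= n)%N by []; elim: {-2}n => [|m IH] mn; first by exists 0%N.
  have [N1 P1] := IH (ltnW mn).
  have [N2 P2] := Ztau_positive (ZtauB (Za _ mn) (Za _ (ltnW mn))) (eq_ind_r _ (aS _ mn) (subr_gt0 _ _)).
  exists (maxn N1 N2) => N'; rewrite geq_max => /andP[h1 h2] i.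
  by rewrite ltnS leq_eqVlt => /predU1P[->|im]; [exact: P2 | exact: P1].
have [w wn wf] : exists2 w, wlen R N.+1 w = a n & forall I, I \in tiles N.+1 0 w -> affine_on f I.
  have : (n <= n)%N by []; elim: {-2}n => [|m IH] mn; first by exists [::]; rewrite ?a0.
  have [w wm wf] := IH (ltnW mn); have [p [q pq]] := NP m mn.
  have E : wlen R N.+1 (nseq p false ++ nseq q true) = a m.+1 - a m.
    rewrite pq wlen_count !count_cat !count_nseq /= !mul1n !mul0n addn0 add0n.
    by [].
  exists (w ++ nseq p false ++ nseq q true); first by rewrite wlen_cat wm E addrC subrK.
  move=> I; rewrite tiles_cat mem_cat add0r => /orP[/wf //|].
  rewrite wm => /tiles_bounds[]; rewrite E [a m + _]addrC subrK => h1 h2 h3.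
  have [Zc fm] := fP m mn.
  have ZI : Ztau I.1 by apply/h3/Za/ltnW.
  have m0 : 0 <= a m by rewrite -a0 am // leq0n ltnW.
  have m1 : a m.+1 <= 1 by rewrite -an am // mn leqnn.
  have GI : golden I by split=> //; lra.
  by apply: (maps_on_piece _ fm GI) => //; split=> //=; [exact/Za/ltnW | exact: Za].
by exists (tiles N.+1 0 w) => //; apply: straight_tiles; rewrite wn.
Qed.

(** After refinement, the target tiling also has only two lengths, which are
    consecutive powers of [t]. *)
Lemma Vtau_swaprot f : Vtau f -> H f.
Proof.
move=> Vf; have [P sP aP] := Vtau_straight_source Vf.
have [N NP] : exists N, forall I, I \in P -> ((img f I).2 <= N)%N.
  exists (\max_(I <- P) (img f I).2) => I IP.
  by rewrite (big_rem I IP) /= leq_maxl.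
have [|P' [sP' aP' lP']] := straight_refine (N := N.+1) sP aP.
  by move=> I IP; apply: leq_trans (NP I IP) _; lia.
have tP' := straight_tiling sP'; have [_ GP' _ _] := tP'.
have m : matches f P' (map (img f) P').
  by split=> // I IP; split; [exact: GP' | exact: aP'].
apply: (straight_matches phiP sP' _ Vf m).
have [uQ GQ dQ cQ] := matches_tiling tP' m.
have [|||w w1 wP] := @tiles_of_tiling R N.+1 _ 0 (map (img f) P') erefl _ _ uQ dQ.
- by rewrite lexx ler01.
- by move=> J JQ; split; [exact: GQ | case/mapP: JQ => I IP ->; exact: lP'].
- move=> x x01; have /andP[-> _] := x01; symmetry; apply/hasP.
  by have [I IQ xI] := cQ (point x01); exists I.
apply: straight_perm (straight_tiles (N := N) (w := w) _); first by rewrite perm_sym.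
by rewrite -w1 add0r.
Qed.

(** A rotation in the kernel would put all of Vtau into the kernel. *)
Lemma Vxz_monolith f : Vxz phi f -> monolith phi f.
Proof.
have Mphi g : monolith phi g -> phi g = 0 by move=> /(monolith_Vxz phiP)[].
have phi_rot g : Vtau g -> cong (monolith phi) g (rotation (unit_itv R)) -> phi g = phi (rotation (unit_itv R)).
  move=> Vg /Mphi; have Vr := rot_Vtau (golden_unit R); have Vr' := VtauV Vr.
  by rewrite (phiM phiP) // (phiV phiP) // => /eqP; rewrite subr_eq0 => /eqP.
move=> [Vf f0]; have [_ [//|cf]] := Vtau_swaprot Vf.
have r0 : phi (rotation (unit_itv R)) = 0 by rewrite -(phi_rot f).
have [_ surj _ _ _] := phiP; have [g Vg g1] := surj 1.
have [_ [/Mphi|/(phi_rot g Vg)]] := Vtau_swaprot Vg; rewrite g1 ?r0; by [].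
Qed.

End Main.

Theorem theorem5p2 (R : realType) (phi : bijection (I01 R) -> 'Z_2)
  (phiP : is_varphi phi) : simple_subgroup (Vxz phi).
Proof.
split; [exact: Vxz_subgroup phiP | exact: Vxz_nontrivial phiP |].
move=> N NN; have [->|nt] := pselect (N = [set 1%g]%classic); [by left | right].
have [_ NK _] := NN; apply/seteqP; split=> // f Kf.
exact: (Vxz_monolith phiP Kf).
Qed.
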